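(* Let $n\ge4$ be a multiple of $4$, let $c_a>0$, $c_e\ge0$, $0<c_l\le c_L$, and let $f\in\mathcal{BL}[c_l,c_L,c_e]$ be geometric: $f(x,y)=g(d(x,y))$ for all $x,y\in\mathcal C$, for some $g:[0,\pi]\to[0,1]$. Let $x^*\in\mathcal C^n$ satisfy $d_\infty(x^*,\Pi_n)\le c_a\sqrt{\log(n)/n}$, let $F=[f(x_i^*,x_j^* )]_{i,j}$ with eigenvalues $\lambda_0^*\ge\dots\ge\lambda_{n-1}^*$, and set $\Delta_1=\lambda_0^*-\lambda_1^*$, $\Delta_2=\lambda_2^*-\lambda_3^*$. Suppose the observed random symmetric matrix $A$ satisfies $A_{ii}=0$ and $A_{ij}=F_{ij}+E_{ij}$ for $i<j$, where the centered independent variables $(E_{ij})_{i<j}$ satisfy the subGaussian(1) condition. Let $\hat x^{\mathrm{VSA}}\in\mathbb R^{2\times n}$ be the output of the vanilla spectral algorithm applied to $A$. Then there exist two constants $C_{lLea}$ and $C'_{lLea}$, depending only on $c_l,c_L,c_e,c_a$, such that, with probability at least $1-1/n^2$, $$\min_{Q\in\mathcal O}\|\hat x^{\mathrm{VSA}}-Qx^*\|_1\le C_{lLea}\frac{n\sqrt{n\log n}}{(\Delta_1\wedge\Delta_2)\vee1}\le C_{lLea}\frac{n\sqrt{n\log n}}{\big[(\Phi_1\wedge\Phi_2)-C'_{lLea}\sqrt{n\log n}\big]\vee1},$$ where $\Phi_1=\mathcal F_{0,n}(g)-\mathcal F_{1,n}(g)$ and $\Phi_2=\min_{2\le j\le\lfloor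 n/2\rfloor}\big(\mathcal F_{1,n}(g)-\mathcal F_{j,n}(g)\big)$.
   Context: $\mathcal C$ is the unit circle in $\mathbb R^2$, identified with unit complex numbers; $x\in\mathcal C$ has argument $\underline x\in[0,2\pi)$; $d(x,y)=|\underline x-\underline y|\wedge(2\pi-|\underline x-\underline y|)$. For $x,y\in\mathcal C^n$, $d_\infty(x,y)=\max_id(x_i,y_i)$. $\Pi_n=\{(e^{\iota2\pi\sigma(j)/n})_{1\le j\le n}:\sigma\text{ a permutation of }\{1,\dots,n\}\}$, $d_\infty(x,\Pi_n)=\min_{y\in\Pi_n}d_\infty(x,y)$. $\mathcal O$ is the orthogonal group of $\mathbb R^2$; tuples in $\mathcal C^n$ are viewed as $2\times n$ matrices and $\|M\|_1$ is the sum of absolute values of entries. $\mathcal{BL}[c_l,c_L,c_e]$ is the set of symmetric functions $f:\mathcal C\times\mathcal C\to[0,1]$ such that for all $x,y,y'\in\mathcal C$, with $\varepsilon_n=c_e\sqrt{\log(n)/n}$: $|f(x,y)-f(x,y')|\le c_Ld(y,y')+\varepsilon_n$; and $f(x,y')-f(x,y)\ge c_l(d(x,y)-d(x,y'))-\varepsilon_n$ whenever $d(x,y)\ge d(x,y')$. SubGaussian(1) condition: for every $B\in\mathbb R^{n\times n}$ and $t\ge0$, $\mathbb P\big[\sum_{i<j}B_{ij}E_{ij}>t\sqrt{\sum_{i<j}B_{ij}^2}\big]\le e^{-t^2/2}$. Vanilla spectral algorithm: for a symmetric matrix $M\in\mathbb R^{N\times N}$ with eigenvalues $\hat\lambda_0\ge\dots\ge\hat\lambda_{N-1}$,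 take orthonormal eigenvectors $\hat u,\hat v$ associated with $\hat\lambda_1,\hat\lambda_2$ and output the $2\times N$ matrix with columns $\sqrt{N/2}\,(\hat u_i,\hat v_i)^T$. Discrete Fourier transform: extend $g$ to $[0,2\pi)$ by $g(t)=g(2\pi-t)$ for $t\in(\pi,2\pi)$; $\mathcal F_{k,n}(g)=\sum_{j=0}^{n-1}g(2\pi j/n)\cos(2\pi jk/n)$ for $k=0,\dots,n-1$. *)

(* Defs.v *)
From HB Require Import structures.
From mathcomp Require Import all_boot all_order all_algebra all_fingroup.
From mathcomp Require Import all_classical all_reals all_analysis.

Set Implicit Arguments.
Unset Strict Implicit.
Unset Printing Implicit Defensive.

Import Order.TTheory GRing.Theory Num.Theory.
Import numFieldNormedType.Exports.

Local Open Scope classical_set_scope.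
Local Open Scope ring_scope.

Definition circle (R : realType) : Type :=
  {z : R * R | z.1 ^+ 2 + z.2 ^+ 2 == 1}.

Lemma cexp_subproof (R : realType) (t : R) :
  (cos t, sin t).1 ^+ 2 + (cos t, sin t).2 ^+ 2 == 1.
Proof. by rewrite /= cos2Dsin2. Qed.

Definition cexp (R : realType) (t : R) : circle R :=
  exist _ (cos t, sin t) (cexp_subproof t).

(* The argument of [x] in [0, 2 pi); exactly one [t] satisfies the predicate,
   so the default value 0 plays no role. *)
Definition carg (R : realType) (x : circle R) : R :=
  xget 0 [set t : R | 0 <= t < 2 * pi /\ cexp t = x].

Definition cdist (R : realType) (x y : circle R) : R :=
  Num.min `|carg x - carg y| (2 * pi - `|carg x - carg y|).

Definition cdist_max (R : realType) (n : nat) (x y : 'I_n -> circle R) : R :=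
  \big[Num.max/0]_(i < n) cdist (x i) (y i).

(* Indices and values of [s] range over 0, ..., n - 1; the successor shifts the
   values to 1, ..., n. *)
Definition regular_tuples (R : realType) (n : nat) : set ('I_n -> circle R) :=
  [set y | exists s : 'S_n,
     forall j, y j = cexp (2 * pi * (s j).+1%:R / n%:R)].
Arguments regular_tuples : clear implicits.

(* The set of tuples is finite and nonempty, so the infimum is a minimum. *)
Definition cdist_regular (R : realType) (n : nat) (x : 'I_n -> circle R) : R :=
  inf [set cdist_max x y | y in regular_tuples R n].

Definition circle_mx (R : realType) (n : nat) (x : 'I_n -> circle R) :
    'M[R]_(2, n) :=
  \matrix_(a < 2, i < n) (if a == 0 then (val (x i)).1 else (val (x i)).2).

Definition mxnorm1 (R : realType) (m n : nat) (M : 'M[R]_(m, n)) : R :=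
  \sum_(i < m) \sum_(j < n) `|M i j|.

(* The orthogonal group is compact and nonempty and the objective continuous, so
   the infimum is a minimum. *)
Definition ortho_loss (R : realType) (n : nat) (X Y : 'M[R]_(2, n)) : R :=
  inf [set mxnorm1 (X - Q *m Y) | Q in [set Q : 'M[R]_2 | Q^T *m Q = 1%:M]].

Definition BLeps (R : realType) (ce : R) (n : nat) : R :=
  ce * Num.sqrt (ln n%:R / n%:R).

Definition BL (R : realType) (cl cL ce : R) (n : nat)
    (f : circle R -> circle R -> R) : Prop :=
  [/\ forall x y, f x y = f y x,
      forall x y, 0 <= f x y <= 1,
      forall x y y', `|f x y - f x y'| <= cL * cdist y y' + BLeps ce n
    & forall x y y', cdist x y' <= cdist x y ->
        cl * (cdist x y - cdist x y') - BLeps ce n <= f x y' - f x y].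

Definition affinity_mx (R : realType) (n : nat) (f : circle R -> circle R -> R)
    (x : 'I_n -> circle R) : 'M[R]_n :=
  \matrix_(i < n, j < n) f (x i) (x j).

(* [s] lists the eigenvalues of [M] with multiplicity, in nonincreasing order. *)
Definition spectrum (R : realType) (n : nat) (M : 'M[R]_n) (s : seq R) : Prop :=
  sorted (fun a b : R => b <= a) s /\
  char_poly M = \prod_(a <- s) ('X - a%:P).

(* The eigenvectors are not unique, so the algorithm is a relation between its
   input and its possible outputs. *)
Definition vanilla_spectral (R : realType) (n : nat) (M : 'M[R]_n)
    (X : 'M[R]_(2, n)) : Prop :=
  exists (s : seq R) (u v : 'cV[R]_n),
    [/\ spectrum M s,
        M *m u = s`_1 *: u /\ M *m v = s`_2 *: v,
        [/\ u^T *m u = 1%:M, v^T *m v = 1%:M & u^T *m v = 0]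
      & X = Num.sqrt (n%:R / 2) *:
            \matrix_(a < 2, i < n) (if a == 0 then u i 0 else v i 0)].

Definition fold_ext (R : realType) (g : R -> R) (t : R) : R :=
  if t <= pi then g t else g (2 * pi - t).

Definition dft (R : realType) (n : nat) (g : R -> R) (k : nat) : R :=
  \sum_(0 <= j < n) fold_ext g (2 * pi * j%:R / n%:R) *
                    cos (2 * pi * j%:R * k%:R / n%:R).

Definition Phi1 (R : realType) (n : nat) (g : R -> R) : R :=
  dft n g 0 - dft n g 1.

(* The seed of the iterated minimum is its term at j = 2, which belongs to the
   range as soon as 4 <= n. *)
Definition Phi2 (R : realType) (n : nat) (g : R -> R) : R :=
  \big[Num.min/(dft n g 1 - dft n g 2)]_(2 <= j < n./2.+1)
    (dft n g 1 - dft n g j).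

Definition mutually_independent (R : realType) (d : measure_display)
    (T : measurableType d) (P : probability T R) (I : finType) (D : {set I})
    (X : I -> T -> R) : Prop :=
  forall (J : {set I}) (B : I -> set R), J \subset D ->
    (forall k, measurable (B k)) ->
    P (\bigcap_(k in [set` J]) (X k @^-1` B k)) =
    (\prod_(k in J) P (X k @^-1` B k))%E.

Definition subgaussian1 (R : realType) (d : measure_display)
    (T : measurableType d) (P : probability T R) (n : nat)
    (E : 'I_n -> 'I_n -> T -> R) : Prop :=
  forall (B : 'M[R]_n) (t : R), 0 <= t ->
    let S := \sum_(i < n) \sum_(j < n | (i < j)%N) B i j ^+ 2 in
    let V w := \sum_(i < n) \sum_(j < n | (i < j)%N) B i j * E i j w in
    (P [set w | (t * Num.sqrt S < V w)%R] <= (expR (- t ^+ 2 / 2))%:E)%E.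

(* The event [A] is not required to be measurable: it contains a measurable event
   of probability at least [p]. *)
Definition with_prob_ge (R : realType) (d : measure_display)
    (T : measurableType d) (P : probability T R) (p : R) (A : set T) : Prop :=
  exists2 G : set T, measurable G /\ G `<=` A & (p%:E <= P G)%E.

(* Main.v *)
(** Let [y] be a regular tuple within O(sqrt (ln n / n)) of [x], and [N] the
    affinity matrix at [y].  Up to a permutation [N] is circulant, so it is
    diagonalized by the Hartley vectors cos + sin, with eigenvalues [dft n g k];
    those for k = 1 and k = n - 1 span the two rows of [circle_mx y].  Entrywise
    the affinity matrix at [x] is O(sqrt (ln n / n)) away from [N], and the noise
    has quadratic form O(sqrt (n ln n)) by a union bound over a grid of mesh
    n ^ -2, so every matrix in sight is within eta = O(sqrt (n ln n)) of [N].

    Almost monotonicity of [g] gives [dft n g k <= dft n g 1 + O(eta)] for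
    0 < k < n: by Abel summation this reduces to the fact that the Dirichlet
    kernels, restricted to the multiples 1, ..., n / 2 of 2 pi / n, are largest at
    the first one.  Counting dimensions then locates the four largest eigenvalues
    of a matrix near [N] up to O(eta), which yields the comparison of the gaps
    Delta and Phi, and shows that the second and third are within O(eta) of
    [dft n g 1].  The eigenvectors returned by the algorithm are thus almost
    eigenvectors of [N], and a Davis-Kahan argument in the Hartley basis leaves
    them O(eta / delta) away from the plane k = 1, n - 1. *)

Require Import Defs.
From HB Require Import structures.
From mathcomp Require Import all_boot all_order all_algebra all_fingroup.
From mathcomp Require Import all_classical all_reals all_analysis.
From mathcomp Require Import ring lra zify.

Set Implicit Arguments.
Unset Strict Implicit.
Unset Printing Implicit Defensive.

Import Order.TTheory GRing.Theory Num.Theory.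
Import numFieldNormedType.Exports.

Local Open Scope classical_set_scope.
Local Open Scope ring_scope.

(** * Orthogonal diagonalization and eigenvalue perturbation *)

(** The gaps of the statement are measured on the affinity matrix at [x], whereas the explicit
    eigenbasis belongs to the one at [y]; eigenvalue bounds are therefore proved for any symmetric
    matrix near [N] and used for the affinity matrix and for the observation alike. The eigenvalue
    [dft n g 1] of [N] is double, so a single eigenvector of the observation has nothing to be
    compared with: only the plane is stable, and two orthonormal vectors lying almost in it are
    matched with the circle by one orthogonal matrix, a rotation or a reflection. Monotonicity of
    [g] holds only up to eps_n, but this slack moves a Fourier coefficient by a multiple of n eps_n
    = c_e sqrt (n ln n), the order of the noise, and is absorbed into eta. When the gap is below a
    multiple of eta, the loss is at most 4 n whatever the eigenvectors, which is already good
    enough. Randomness enters through a single event, on which every possible output of the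
    algorithm is treated. *)

Lemma row_sqr_sum (R : realType) (n : nat) (x : 'rV[R]_n) :
  (x *m x^T) 0 0 = \sum_i x 0 i ^+ 2.
Proof. by rewrite mxE; apply: eq_bigr => i _; rewrite mxE expr2. Qed.

Lemma row_sqr_gt0 (R : realType) (n : nat) (x : 'rV[R]_n) :
  x != 0 -> 0 < \sum_i x 0 i ^+ 2.
Proof.
move=> xN0; rewrite lt_def sumr_ge0 ?andbT; last by move=> i _; rewrite sqr_ge0.
apply: contra xN0 => /eqP/psumr_eq0P x0; apply/eqP/rowP => i; rewrite mxE.
by apply/eqP; rewrite -sqrf_eq0 x0 // => j _; rewrite sqr_ge0.
Qed.

Lemma row_dotC (R : realType) (n : nat) (u v : 'rV[R]_n) :
  u *m v^T = v *m u^T.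
Proof.
by apply/matrixP => i j; rewrite !ord1 !mxE; apply: eq_bigr => k _;
  rewrite !mxE mulrC.
Qed.

(* Householder reflection exchanging the first basis vector and [u]. *)
Lemma unit_row_completion (R : realType) (n : nat) (u : 'rV[R]_(1 + n)) :
  u *m u^T = 1%:M -> exists2 H : 'M[R]_(1 + n), H *m H^T = 1%:M & row 0 H = u.
Proof.
move=> uu; pose e : 'rV[R]_(1 + n) := delta_mx 0 0.
have [->|ueN] := eqVneq u e.
  by exists 1%:M; rewrite ?trmx1 ?mulmx1 // row1.
have [w wE] : exists w, w = e - u by exists (e - u).
pose a := (w *m w^T) 0 0.
have a_gt0 : 0 < a by rewrite /a row_sqr_sum row_sqr_gt0 // wE subr_eq0 eq_sym.
have aE : w *m w^T = a%:M by rewrite [LHS]mx11_scalar.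
have ee : e *m e^T = 1%:M.
  by rewrite /e trmx_delta mul_delta_mx -[LHS]mul1mx; apply/matrixP => i j;
    rewrite !ord1 mul1mx !mxE !eqxx.
have ew : e *m w^T = (a / 2)%:M.
  have H : w *m w^T = e *m w^T + e *m w^T.
    rewrite {1}wE mulmxBl wE linearB /= !mulmxBr uu ee.
    by rewrite (row_dotC u e) opprB addrC.
  apply/matrixP => i j; rewrite !ord1 [RHS]mxE eqxx mulr1n.
  move/matrixP: H => /(_ 0 0); rewrite aE mxE eqxx mulr1n [RHS]mxE => ->.
  by field.
exists (1%:M - (2 / a) *: (w^T *m w)).
  have -> : (1%:M - (2 / a) *: (w^T *m w))^T = 1%:M - (2 / a) *: (w^T *m w).
    by rewrite linearB /= linearZ /= trmx_mul trmxK trmx1.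
  rewrite mulmxBr mulmx1 mulmxBl mul1mx -scalemxAr -scalemxAl.
  rewrite -mulmxA [in X in _ - X](mulmxA w) aE mul_scalar_mx.
  rewrite -scalemxAr !scalerA.
  have -> : 2 / a * (2 / a) * a = 2 / a + 2 / a.
    by field; rewrite gt_eqF.
  by rewrite scalerDl; set Z := _ *: _; rewrite opprB addrK subrK.
rewrite rowE mulmxBr mulmx1 -scalemxAr mulmxA ew mul_scalar_mx scalerA.
have -> : 2 / a * (a / 2) = 1 by field; rewrite gt_eqF.
by rewrite scale1r wE opprB addrCA subrr addr0.
Qed.

Lemma char_poly_ortho_conj (R : realType) (n : nat) (M H : 'M[R]_n) :
  H *m H^T = 1%:M -> char_poly (H *m M *m H^T) = char_poly M.
Proof.
move=> HH; rewrite /char_poly /char_poly_mx.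
have HHp : map_mx polyC H *m map_mx polyC (H^T) = 1%:M :> 'M[{poly R}]_n.
  by rewrite -map_mxM HH map_mx1.
rewrite !map_mxM.
have -> : 'X%:M - map_mx polyC H *m map_mx polyC M *m map_mx polyC (H^T) =
    map_mx polyC H *m ('X%:M - map_mx polyC M) *m map_mx polyC (H^T).
  by rewrite mulmxBr mulmxBl scalar_mxC -['X%:M *m _ *m _]mulmxA HHp mulmx1.
have := congr1 determinant HHp; rewrite !det_mulmx det1 => dHH.
by rewrite mulrAC dHH mul1r.
Qed.

Lemma char_poly_block_diag (R : realType) (n : nat) (a : R) (B : 'M[R]_n) :
  char_poly (block_mx (a%:M : 'M[R]_1) 0 0 B : 'M[R]_(1 + n)) =
  ('X - a%:P) * char_poly B.
Proof.
rewrite /char_poly char_block_diag_mx det_ublock; congr (_ * _).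
by rewrite /char_poly_mx map_scalar_mx -raddfB /= det_scalar1.
Qed.

(** Deflation: a unit eigenvector for the head of [s] is completed to an orthogonal matrix, and the
    remaining block has the tail of [s] as its roots. The diagonal thus carries the given list in
    its given order, so that a sorted spectrum can be read off by index. *)
Lemma symmetric_ortho_diag (R : realType) (n : nat) (M : 'M[R]_n) (s : seq R) :
  M^T = M -> char_poly M = \prod_(a <- s) ('X - a%:P) ->
  exists2 Q : 'M[R]_n, Q *m Q^T = 1%:M &
    M = Q^T *m diag_mx (\row_i s`_i) *m Q.
Proof.
elim: n => [|n IH] in M s * => Msym Mchar.
  by exists 1%:M; apply/matrixP; case.
case: s => [|a s] in Mchar *.
  have := size_char_poly M; rewrite Mchar big_nil size_poly1 => /eqP.
  by rewrite eqSS eq_sym.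
have : eigenvalue M a.
  by rewrite eigenvalue_root_char Mchar big_cons rootM root_XsubC eqxx.
move=> /eigenvalueP[v vM vN0].
pose c := Num.sqrt (\sum_i v 0 i ^+ 2).
have c_gt0 : 0 < c by rewrite sqrtr_gt0 row_sqr_gt0.
pose u : 'rV_(1 + n) := c^-1 *: v.
have uM : u *m M = a *: u by rewrite -scalemxAl vM !scalerA mulrC.
have uu : u *m u^T = 1%:M.
  rewrite linearZ /= -scalemxAr -scalemxAl scalerA [v *m _]mx11_scalar row_sqr_sum.
  rewrite -[\sum_i _]sqr_sqrtr; last by rewrite sumr_ge0 // => i; rewrite sqr_ge0.
  by rewrite -/c scale_scalar_mx; congr (_%:M); field; rewrite gt_eqF.
have [H HH Hu] := unit_row_completion uu.
have [N NdE] : exists N : 'M[R]_(1 + n), N = H *m M *m H^T by eexists.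
have Nsym : N^T = N by rewrite NdE !trmx_mul trmxK Msym mulmxA.
have row0N : row 0 N = a *: delta_mx 0 0.
  rewrite NdE !row_mul Hu uM -scalemxAl; congr (_ *: _).
  by rewrite -{1}Hu rowE -mulmxA HH mulmx1.
have NE : N = block_mx (a%:M : 'M[R]_1) 0 0 (drsubmx N).
  rewrite -[LHS]submxK; congr block_mx.
  - apply/matrixP => i j; rewrite !ord1 !mxE.
    have /rowP/(_ (lshift n 0)) := row0N; rewrite !mxE.
    have -> : lshift n (0 : 'I_1) = 0 by apply/val_inj.
    by rewrite !eqxx mulr1 mulr1n.
  - apply/matrixP => i j; rewrite !ord1 !mxE.
    have /rowP/(_ (rshift 1 j)) := row0N; rewrite !mxE.
    have -> : lshift n (0 : 'I_1) = 0 by apply/val_inj.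
    by rewrite -val_eqE /= mulr0.
  - apply/matrixP => i j; rewrite !ord1 -Nsym !mxE.
    have /rowP/(_ (rshift 1 i)) := row0N; rewrite !mxE.
    have -> : lshift n (0 : 'I_1) = 0 by apply/val_inj.
    by rewrite -val_eqE /= mulr0.
have Bsym : (drsubmx N)^T = drsubmx N by rewrite trmx_drsub Nsym.
have Bchar : char_poly (drsubmx N) = \prod_(b <- s) ('X - b%:P).
  have := char_poly_ortho_conj M HH; rewrite -NdE Mchar {1}NE char_poly_block_diag.
  by rewrite big_cons => /mulfI; apply; rewrite polyXsubC_eq0.
have [Q QQ BE] := IH _ _ Bsym Bchar.
have HTH : H^T *m H = 1%:M by apply: mulmx1C.
pose B : 'M[R]_(1 + n) := block_mx (1%:M : 'M[R]_1) 0 0 Q.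
pose D : 'M[R]_(1 + n) :=
  block_mx (a%:M : 'M[R]_1) 0 0 (diag_mx (\row_i s`_i)).
have BT : B^T = block_mx (1%:M : 'M[R]_1) 0 0 Q^T.
  by rewrite tr_block_mx !trmx0 trmx1.
have BB : B *m B^T = 1%:M.
  rewrite BT mulmx_block !mul0mx !mulmx0 !addr0 !add0r QQ mulmx1.
  by rewrite -scalar_mx_block.
have NBD : N = B^T *m D *m B.
  rewrite NE BE BT !mulmx_block.
  by rewrite !mul0mx !mulmx0 !addr0 !add0r !mul0mx !mul1mx mulmx1.
have DE : diag_mx (\row_i (a :: s)`_i) = D.
  rewrite /D -[LHS](@submxK _ 1 n 1 n); congr block_mx;
    by apply/matrixP => i j; rewrite ?ord1 !mxE -val_eqE /= ?eqSS.
exists (B *m H).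
  by rewrite trmx_mul mulmxA -[X in X *m _]mulmxA HH mulmx1.
transitivity (H^T *m N *m H).
  by rewrite NdE !mulmxA HTH mul1mx -mulmxA HTH mulmx1.
by rewrite DE NBD trmx_mul !mulmxA.
Qed.

(** * Quadratic forms and the Courant-Fischer dimension count *)

Definition qform (R : realType) (n : nat) (M : 'M[R]_n) (x : 'rV[R]_n) : R :=
  (x *m M *m x^T) 0 0.

Definition sqnorm (R : realType) (n : nat) (x : 'rV[R]_n) : R :=
  \sum_i x 0 i ^+ 2.

Lemma sqnorm_ge0 (R : realType) (n : nat) (x : 'rV[R]_n) : 0 <= sqnorm x.
Proof. by apply: sumr_ge0 => i _; rewrite sqr_ge0. Qed.

Lemma sqnorm_ortho (R : realType) (n : nat) (Q : 'M[R]_n) (x : 'rV[R]_n) :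
  Q *m Q^T = 1%:M -> sqnorm (x *m Q^T) = sqnorm x.
Proof.
move=> /mulmx1C QQ; rewrite /sqnorm -!row_sqr_sum trmx_mul trmxK mulmxA.
by rewrite -[x *m _ *m _]mulmxA QQ mulmx1.
Qed.

Lemma qform_ortho_diag (R : realType) (n : nat) (Q : 'M[R]_n) (d x : 'rV[R]_n) :
  qform (Q^T *m diag_mx d *m Q) x = \sum_i d 0 i * (x *m Q^T) 0 i ^+ 2.
Proof.
have -> : qform (Q^T *m diag_mx d *m Q) x =
    ((x *m Q^T) *m diag_mx d *m (x *m Q^T)^T) 0 0.
  by rewrite /qform trmx_mul trmxK !mulmxA.
rewrite mxE; apply: eq_bigr => i _; rewrite mul_mx_diag !mxE.
by rewrite expr2 mulrAC mulrC.
Qed.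

Lemma qformB (R : realType) (n : nat) (M N : 'M[R]_n) (x : 'rV[R]_n) :
  qform (M - N) x = qform M x - qform N x.
Proof. by rewrite /qform mulmxBr mulmxBl !mxE. Qed.

Lemma qformD (R : realType) (n : nat) (M N : 'M[R]_n) (x : 'rV[R]_n) :
  qform (M + N) x = qform M x + qform N x.
Proof. by rewrite /qform mulmxDr mulmxDl !mxE. Qed.

Lemma qformE (R : realType) (n : nat) (M : 'M[R]_n) (x : 'rV[R]_n) :
  qform M x = \sum_i \sum_j x 0 i * M i j * x 0 j.
Proof.
rewrite /qform mxE exchange_big; apply: eq_bigr => j _.
by rewrite mxE mulr_suml; apply: eq_bigr => i _; rewrite mxE.
Qed.

(** Fewer than [n] linear conditions on [n] unknowns. The two families are coordinates in two
    different bases, which is the shape needed to test two matrices on one vector. *)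
Lemma common_kernel (R : realType) (n : nat) (I1 I2 : {set 'I_n})
    (K1 K2 : 'M[R]_n) :
  (#|I1| + #|I2| < n)%N ->
  exists x : 'rV[R]_n, [/\ x != 0, forall j, j \in I1 -> (x *m K1) 0 j = 0
    & forall j, j \in I2 -> (x *m K2) 0 j = 0].
Proof.
move=> lt_n.
pose K := row_mx (colsub (fun i : 'I_(#|I1|) => enum_val i) K1)
                 (colsub (fun i : 'I_(#|I2|) => enum_val i) K2).
have : kermx K != 0.
  rewrite kermx_eq0 /row_free neq_ltn (leq_ltn_trans _ lt_n) //.
  exact: rank_leq_col.
move=> /rowV0Pn[x /sub_kermxP xK xN0]; exists x; split=> // j jI.
- have := congr1 lsubmx xK; rewrite mul_mx_row row_mxKl => /rowP.
  move=> /(_ (enum_rank_in jI j)); rewrite [RHS]mxE [RHS]mxE => <-.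
  by rewrite !mxE; apply: eq_bigr => i _; rewrite mxE enum_rankK_in.
- have := congr1 rsubmx xK; rewrite mul_mx_row row_mxKr => /rowP.
  move=> /(_ (enum_rank_in jI j)); rewrite [RHS]mxE [RHS]mxE => <-.
  by rewrite !mxE; apply: eq_bigr => i _; rewrite mxE enum_rankK_in.
Qed.

Lemma card_ord_lt (n k : nat) : (k <= n)%N -> #|[set i : 'I_n | (i < k)%N]%SET| = k.
Proof.
move=> le_kn; transitivity #|[set widen_ord le_kn i | i : 'I_k]%SET|.
  apply: eq_card => i; rewrite inE; apply/idP/imsetP => [lt_ik|[j _ ->]].
    by exists (Ordinal lt_ik) => //; apply: val_inj.
  exact: (ltn_ord j).
by rewrite card_imset ?card_ord // => i j /(congr1 val)/= /val_inj.
Qed.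

Lemma sorted_ge_nth (R : realType) (s : seq R) (i j : nat) :
  sorted (fun a b : R => b <= a) s -> (i <= j < size s)%N -> s`_j <= s`_i.
Proof.
move=> s_sorted /andP[le_ij lt_j].
have tr : transitive (fun a b : R => b <= a).
  by move=> b a c ab bc; apply: le_trans bc ab.
by apply: (sorted_leq_nth tr _ 0 s_sorted) => //; rewrite inE ?(leq_ltn_trans le_ij).
Qed.

Section Perturbation.
Variables (R : realType) (n : nat) (M N H Q : 'M[R]_n) (phi : 'rV[R]_n).
Variables (s : seq R) (eta : R).
Hypothesis HH : H *m H^T = 1%:M.
Hypothesis NE : N = H^T *m diag_mx phi *m H.
Hypothesis QQ : Q *m Q^T = 1%:M.
Hypothesis ME : M = Q^T *m diag_mx (\row_i s`_i) *m Q.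
Hypothesis s_sorted : sorted (fun a b : R => b <= a) s.
Hypothesis s_size : size s = n.
Hypothesis MN : forall x, `|qform (M - N) x| <= eta * sqnorm x.

(** A vector with no component along the eigenvectors of [N] indexed by [J], nor along those of [M]
    of index beyond [k], has Rayleigh quotient at most [t] for [N] and at least the [k]-th
    eigenvalue for [M]. The set [J] stands in for an ordering of [phi], which is not sorted. *)
Lemma diag_eigenvalue_le (k : nat) (t : R) (J : {set 'I_n}) :
  (k < n)%N -> (#|J| <= k)%N -> (forall j, j \notin J -> phi 0 j <= t) ->
  s`_k <= t + eta.
Proof.
move=> lt_kn Jk phi_le.
have card_lt : (#|J| + #|~: [set i : 'I_n | (i < k.+1)%N]%SET| < n)%N.
  rewrite [#|~: _|]cardsCs finset.setCK card_ord_lt // card_ord.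
  by move: Jk lt_kn; lia.
have [x [xN0 xJ xk]] := common_kernel H^T Q^T card_lt.
have x_gt0 : 0 < sqnorm x by apply: row_sqr_gt0.
rewrite -(ler_pM2r x_gt0).
have le1 : qform N x <= t * sqnorm x.
  rewrite NE qform_ortho_diag -(sqnorm_ortho x HH) /sqnorm mulr_sumr.
  apply: ler_sum => j _; have [jJ|/phi_le] := boolP (j \in J).
    by rewrite xJ // expr0n /= !mulr0.
  by apply: ler_wpM2r; rewrite sqr_ge0.
have le2 : s`_k * sqnorm x <= qform M x.
  rewrite ME qform_ortho_diag -(sqnorm_ortho x QQ) /sqnorm mulr_sumr.
  apply: ler_sum => j _; have [kj|jk] := ltnP k j.
    by rewrite xk ?expr0n /= ?mulr0 // !inE ltnS -ltnNge.
  rewrite [(\row_i s`_i) 0 j]mxE; apply: ler_wpM2r; rewrite ?sqr_ge0 //.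
  by apply: sorted_ge_nth => //; rewrite jk s_size.
have := MN x; rewrite qformB => /(le_trans (ler_norm _)); rewrite mulrDl; lra.
Qed.

Lemma diag_eigenvalue_ge (k : nat) (t : R) (J : {set 'I_n}) :
  (k < n)%N -> (k < #|J|)%N -> (forall j, j \in J -> t <= phi 0 j) ->
  t - eta <= s`_k.
Proof.
move=> lt_kn Jk phi_ge.
have card_lt : (#|~: J| + #|[set i : 'I_n | (i < k)%N]%SET| < n)%N.
  rewrite card_ord_lt ?(ltnW lt_kn) // [#|~: _|]cardsCs finset.setCK card_ord.
  have le_Jn : (#|J| <= n)%N by rewrite -[leqRHS]card_ord max_card.
  by move: Jk le_Jn; lia.
have [x [xN0 xJ xk]] := common_kernel H^T Q^T card_lt.
have x_gt0 : 0 < sqnorm x by apply: row_sqr_gt0.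
rewrite -(ler_pM2r x_gt0).
have le1 : t * sqnorm x <= qform N x.
  rewrite NE qform_ortho_diag -(sqnorm_ortho x HH) /sqnorm mulr_sumr.
  apply: ler_sum => j _; have [/phi_ge|jJ] := boolP (j \in J).
    by apply: ler_wpM2r; rewrite sqr_ge0.
  by rewrite xJ ?inE // expr0n /= !mulr0.
have le2 : qform M x <= s`_k * sqnorm x.
  rewrite ME qform_ortho_diag -(sqnorm_ortho x QQ) /sqnorm mulr_sumr.
  apply: ler_sum => j _; have [jk|kj] := ltnP j k.
    by rewrite xk ?expr0n /= ?mulr0 // inE.
  rewrite [(\row_i s`_i) 0 j]mxE; apply: ler_wpM2r; rewrite ?sqr_ge0 //.
  by apply: sorted_ge_nth => //; rewrite kj s_size /=.
have := MN x; rewrite qformB ler_norml => /andP[+ _]; rewrite mulrBl; lra.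
Qed.
End Perturbation.

(* Polarization at [x] and a multiple of [x *m M]. *)
Lemma sqnorm_mulmx_le (R : realType) (n : nat) (M : 'M[R]_n) (eta : R) :
  0 < eta -> M^T = M -> (forall x, `|qform M x| <= eta * sqnorm x) ->
  forall x, sqnorm (x *m M) <= eta ^+ 2 * sqnorm x.
Proof.
move=> eta_gt0 Msym Mle x.
pose y := eta^-1 *: (x *m M).
have ydot : (x *m M *m y^T) 0 0 = eta^-1 * sqnorm (x *m M).
  by rewrite linearZ /= -scalemxAr mxE row_sqr_sum.
have ydot' : (y *m M *m x^T) 0 0 = eta^-1 * sqnorm (x *m M).
  by rewrite -ydot -mulmxA -{1}Msym -trmx_mul row_dotC.
have YX : (y *m M *m x^T) 0 0 = (x *m M *m y^T) 0 0 by rewrite ydot ydot'.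
have mxD (A B : 'M[R]_1) : (A + B) 0 0 = A 0 0 + B 0 0 by rewrite mxE.
have mxB (A B : 'M[R]_1) : (A - B) 0 0 = A 0 0 - B 0 0 by rewrite !mxE.
have qD : qform M (x + y) - qform M (x - y) = 4 * (eta^-1 * sqnorm (x *m M)).
  have -> : qform M (x + y) = qform M x + (x *m M *m y^T) 0 0 +
      ((y *m M *m x^T) 0 0 + qform M y).
    by rewrite /qform linearD /= !mulmxDl !mulmxDr !mxD.
  have -> : qform M (x - y) = qform M x - (x *m M *m y^T) 0 0 -
      ((y *m M *m x^T) 0 0 - qform M y).
    by rewrite /qform linearB /= !mulmxBl !mulmxBr !mxB.
  by rewrite YX ydot; ring.
have nD : sqnorm (x + y) + sqnorm (x - y) = 2 * sqnorm x + 2 * sqnorm y.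
  rewrite /sqnorm !mulr_sumr -!big_split; apply: eq_bigr => i _ /=.
  by rewrite !mxE; ring.
have ny : sqnorm y = eta^-1 ^+ 2 * sqnorm (x *m M).
  by rewrite /sqnorm mulr_sumr; apply: eq_bigr => i _; rewrite mxE exprMn.
have h1 := Mle (x + y); have h2 := Mle (x - y).
have : 4 * (eta^-1 * sqnorm (x *m M)) <=
    eta * (2 * sqnorm x + 2 * (eta^-1 ^+ 2 * sqnorm (x *m M))).
  rewrite -qD -ny -nD mulrDr; move: h1 h2; rewrite !ler_norml.
  move=> /andP[_ h1] /andP[h2 _]; lra.
have -> : eta * (2 * sqnorm x + 2 * (eta^-1 ^+ 2 * sqnorm (x *m M))) =
    2 * (eta * sqnorm x) + 2 * (eta^-1 * sqnorm (x *m M)).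
  by field; rewrite gt_eqF.
move=> h; have : eta^-1 * sqnorm (x *m M) <= eta * sqnorm x by lra.
by rewrite ler_pdivrMl // mulrA -expr2.
Qed.

(** * Dirichlet kernels and Abel summation *)

(** By the addition formula the ratio of sin ((k + 1) x) to sin x is cos x times the ratio for k,
    plus cos (k x); as long as the angles stay below pi / 2, all of these are nonnegative and
    nonincreasing. Cleared denominators admit [x = 0]. *)
Lemma sin_ratio_decr (R : realType) (k : nat) (x y : R) :
  0 <= x -> x <= y -> k%:R * y <= pi / 2 ->
  sin (k%:R * y) * sin x <= sin (k%:R * x) * sin y.
Proof.
move=> x0 xy; have y0 : 0 <= y by apply: le_trans xy.
have pi0 := pi_gt0 R.
elim: k => [|k IH] ky; first by rewrite !mul0r sin0 !mul0r.
have [->|k_gt0] := posnP k; first by rewrite !mul1r mulrC.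
have k1 : 1 <= k%:R :> R by rewrite ler1n.
have kS : k.+1%:R = k%:R + 1 :> R by rewrite -natr1.
have ky' : k%:R * y <= pi / 2 by apply: le_trans ky; rewrite kS; nra.
have yh : y <= pi / 2 by nra.
have {}IH := IH ky'.
have kx0 : 0 <= k%:R * x by rewrite mulr_ge0.
have kxy : k%:R * x <= k%:R * y by rewrite ler_wpM2l // (le_trans ler01).
have cosxy : cos y <= cos x.
  have [->//|xyN] := eqVneq x y; apply/ltW; rewrite ltr_cos ?in_itv /=; last 2 first.
  - by apply/andP; split; lra.
  - by apply/andP; split; lra.
  by rewrite lt_neqAle xyN.
have coskxy : cos (k%:R * y) <= cos (k%:R * x).
  have [->//|xyN] := eqVneq (k%:R * x) (k%:R * y).
  apply/ltW; rewrite ltr_cos ?in_itv /=; last 2 first.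
  - by apply/andP; split; lra.
  - by apply/andP; split; lra.
  by rewrite lt_neqAle xyN.
have cosy0 : 0 <= cos y by apply: cos_ge0_pihalf; apply/andP; split; lra.
have sinx0 : 0 <= sin x by apply: sin_ge0_pi; apply/andP; split; lra.
have siny0 : 0 <= sin y by apply: sin_ge0_pi; apply/andP; split; lra.
have sinkx0 : 0 <= sin (k%:R * x) by apply: sin_ge0_pi; apply/andP; split; lra.
rewrite kS !mulrDl !mul1r !sinD !mulrDl.
apply: lerD; last first.
  by rewrite -!mulrA [sin y * sin x]mulrC ler_wpM2r ?mulr_ge0.
rewrite mulrAC [leRHS]mulrAC.
apply: (le_trans (y := sin (k%:R * x) * sin y * cos y)).
  by apply: ler_wpM2r.
by apply: ler_wpM2l => //; rewrite mulr_ge0.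
Qed.

Lemma sin_natpiB (R : realType) (k : nat) (x : R) :
  `|sin (k%:R * (pi - x))| = `|sin (k%:R * x)|.
Proof.
have -> : k%:R * (pi - x) = - (k%:R * x) + pi *+ k.
  by rewrite -[pi *+ k]mulr_natl; ring.
rewrite (alternatingn (@sinDpi R)) normrM sinN normrN.
by rewrite normrX normrN1 expr1n mul1r.
Qed.

(* For [k a > pi / 2] the left ratio [|sin (k a)| / sin a] is at most
   [1 / sin (pi / 2 k)], which is the value of the right ratio at
   [pi / 2 k >= phi]. *)
Lemma sin_ratio_le (R : realType) (k : nat) (phi a : R) :
  0 < phi -> phi <= a -> a <= pi - phi -> (0 < k)%N -> k%:R * phi <= pi / 2 ->
  `|sin (k%:R * a)| * sin phi <= sin a * sin (k%:R * phi).
Proof.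
move=> phi0; have pi0 := pi_gt0 R.
wlog ah : a / a <= pi / 2.
  move=> hw pa ap k0 kphi; have [?|ha] := leP a (pi / 2); first exact: hw.
  have := hw (pi - a); rewrite sin_natpiB.
  have -> : sin (pi - a) = sin a by rewrite sinB sinpi cospi; ring.
  by apply => //; lra.
move=> pa _ k0 kphi.
have k1 : 1 <= k%:R :> R by rewrite ler1n.
have [ka|ka] := leP (k%:R * a) (pi / 2).
  rewrite ger0_norm; last by apply: sin_ge0_pi; apply/andP; split; nra.
  by rewrite mulrC [leRHS]mulrC mulrC; apply: sin_ratio_decr => //; apply: ltW.
set b : R := pi / 2 / k%:R.
have kN0 : k%:R != 0 :> R by rewrite pnatr_eq0 -lt0n.
have kb : k%:R * b = pi / 2 by rewrite /b mulrC divfK.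
have pb : phi <= b by rewrite /b ler_pdivlMr ?ltr0n // mulrC.
have ba : b <= a by rewrite /b ler_pdivrMr ?ltr0n // [a * _]mulrC ltW.
have sphi0 : 0 <= sin phi by apply: sin_ge0_pi; apply/andP; split; lra.
have skphi0 : 0 <= sin (k%:R * phi) by apply: sin_ge0_pi; apply/andP; split; nra.
apply: (le_trans (y := sin phi)); first by rewrite ler_piMl // sin_max.
have := @sin_ratio_decr R k phi b (ltW phi0) pb.
rewrite kb sin_pihalf mul1r => /(_ (lexx _)) h; apply: le_trans h _.
rewrite mulrC; apply: ler_wpM2r => //.
have [->//|baN] := eqVneq b a; apply/ltW.
by rewrite ltr_sin ?in_itv /= ?lt_neqAle ?baN //; apply/andP; split; lra.
Qed.

Lemma dirichlet_kernel (R : realType) (m : nat) (x : R) :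
  (1 + 2 * \sum_(1 <= l < m.+1) cos (l%:R * (2 * x))) * sin x =
  sin ((2 * m + 1)%:R * x).
Proof.
elim: m => [|m IH].
  by rewrite big_nil mulr0 addr0 !mul1r.
rewrite big_nat_recr //= mulrDr addrA mulrDl IH.
have -> : (2 * m + 1)%:R * x = m.+1%:R * (2 * x) - x :> R.
  by rewrite natrD natrM -[m.+1%:R]natr1; ring.
have -> : (2 * m.+1 + 1)%:R * x = m.+1%:R * (2 * x) + x :> R.
  by rewrite natrD natrM; ring.
by rewrite sinB sinD; ring.
Qed.

(** With phi = pi / n and a = (2 m + 1) phi, the kernels are sin (k a) / sin (k phi) and sin a / sin
    phi. Reading the angle (2 m + 1) k phi as k times a turns the comparison into [sin_ratio_le] at
    [a], and 2 m + 1 < n is what keeps a below pi - phi. *)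
Lemma dirichlet_kernel_le (R : realType) (n m k : nat) :
  (0 < n)%N -> (2 * m + 1 < n)%N -> (0 < k)%N -> (2 * k <= n)%N ->
  \sum_(1 <= l < m.+1) cos (l%:R * (2 * (k%:R * (pi / n%:R)))) <=
  \sum_(1 <= l < m.+1) cos (l%:R * (2 * (pi / n%:R))) :> R.
Proof.
move=> n0 mn k0 kn; set phi : R := pi / n%:R.
have pi0 := pi_gt0 R; have nR0 : 0 < n%:R :> R by rewrite ltr0n.
have nphi : n%:R * phi = pi by rewrite mulrC divfK ?gt_eqF.
have phi0 : 0 < phi by rewrite divr_gt0.
have kphi : k%:R * phi <= pi / 2.
  have : 2 * k%:R <= n%:R :> R by rewrite -natrM ler_nat.
  by rewrite ler_pdivlMr // -nphi; nra.
have sphi : 0 < sin phi.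
  apply: sin_gt0_pi; rewrite phi0 -nphi ltr_pMl // ltr1n; lia.
have k1 : 1 <= k%:R :> R by rewrite ler1n.
have skphi : 0 < sin (k%:R * phi).
  by apply: sin_gt0_pi; apply/andP; split; [rewrite mulr_gt0 ?ltr0n|lra].
have a1 : phi <= (2 * m + 1)%:R * phi.
  by rewrite ler_pMl // ler1n addn1.
have a2 : (2 * m + 1)%:R * phi <= pi - phi.
  have : (2 * m + 1 + 1)%:R * phi <= n%:R * phi.
    by rewrite ler_wpM2r ?(ltW phi0) // ler_nat addn1.
  by rewrite nphi natrD mulrDl mul1r => h; lra.
have := sin_ratio_le phi0 a1 a2 k0 kphi.
have e1 := dirichlet_kernel m phi; have e2 := dirichlet_kernel m (k%:R * phi).
rewrite mulrCA -e1 -e2 => h.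
set S2 := (X in X <= _); set S1 := (X in _ <= X).
have {}h : (1 + 2 * S2) * sin (k%:R * phi) * sin phi <=
           (1 + 2 * S1) * sin phi * sin (k%:R * phi).
  by apply: le_trans h; rewrite ler_wpM2r ?(ltW sphi) // ler_norm.
move: h; rewrite mulrAC ler_pM2r // ler_pM2r //; lra.
Qed.

Definition root_angle (R : realType) (n m : nat) : R := 2 * pi * m%:R / n%:R.
Arguments root_angle : clear implicits.

Lemma root_angleD (R : realType) (n a b : nat) :
  root_angle R n (a + b) = root_angle R n a + root_angle R n b.
Proof. by rewrite /root_angle natrD; ring. Qed.

Lemma root_angle_full (R : realType) (n q : nat) :
  (0 < n)%N -> root_angle R n (q * n) = pi *+ 2 *+ q.
Proof.
move=> n0; rewrite /root_angle natrM mulrA mulfK; last by rewrite pnatr_eq0 -lt0n.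
by rewrite mulr_natr mulr_natl.
Qed.

Lemma cos_root_angle_periodic (R : realType) (n q : nat) (x : R) :
  (0 < n)%N -> cos (x + root_angle R n (q * n)) = cos x.
Proof. by move=> n0; rewrite root_angle_full // (periodicn (@cosD2pi R)). Qed.

Lemma sin_root_angle_periodic (R : realType) (n q : nat) (x : R) :
  (0 < n)%N -> sin (x + root_angle R n (q * n)) = sin x.
Proof. by move=> n0; rewrite root_angle_full // (periodicn (@sinD2pi R)). Qed.

Lemma cos_root_angle_neq1 (R : realType) (n m : nat) :
  (0 < n)%N -> ~~ (n %| m)%N -> cos (root_angle R n m) != 1.
Proof.
move=> n0 nm; rewrite (divn_eq m n) addnC root_angleD cos_root_angle_periodic //.
have r0 : (0 < m %% n)%N by rewrite lt0n.
have rn : (m %% n < n)%N by rewrite ltn_mod.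
set r := (m %% n)%N in r0 rn *; set x : R := pi * r%:R / n%:R.
have pi0 := pi_gt0 R.
have -> : root_angle R n r = x *+ 2 by rewrite /root_angle /x -mulr_natr; ring.
have sx : 0 < sin x.
  apply: sin_gt0_pi; rewrite divr_gt0 ?mulr_gt0 ?ltr0n //=.
  by rewrite ltr_pdivrMr ?ltr0n // ltr_pM2l // ltr_nat.
rewrite cos_mulr2n cos2sin2; apply/eqP.
have : 0 < sin x ^+ 2 by rewrite exprn_gt0.
by rewrite mulr2n; lra.
Qed.

(* Both sums are invariant under rotation by the angle of [m]. *)
Lemma sum_cos_sin_root_angle (R : realType) (n m : nat) : (0 < n)%N ->
  \sum_(k < n) cos (root_angle R n (k * m)) = (if (n %| m)%N then n%:R else 0) /\
  \sum_(k < n) sin (root_angle R n (k * m)) = 0.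
Proof.
move=> n0; have [/dvdnP[q ->]|nm] := ifPn.
  split.
    rewrite (eq_bigr (fun=> 1)); first by rewrite sumr_const card_ord.
    move=> k _; rewrite mulnA -[root_angle _ _ _]add0r cos_root_angle_periodic //.
    by rewrite cos0.
  rewrite big1 // => k _; rewrite mulnA -[root_angle _ _ _]add0r.
  by rewrite sin_root_angle_periodic // sin0.
set S := \sum_(k < n) cos _; set T := \sum_(k < n) sin _.
set x := root_angle R n m.
have shift (F : nat -> R) : F n = F 0 -> \sum_(k < n) F k.+1 = \sum_(k < n) F k.
  move=> Fn; have : \sum_(k < n.+1) F k = \sum_(k < n) F k + F n.
    by rewrite big_ord_recr.
  by rewrite big_ord_recl /= Fn addrC => /addIr.
have eS : S = cos x * S - sin x * T.
  rewrite -[LHS](shift (fun k => cos (root_angle R n (k * m)))); last first.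
    by rewrite -[(n * m)%N]add0n mulnC root_angleD cos_root_angle_periodic.
  rewrite !mulr_sumr -sumrB; apply: eq_bigr => k _.
  by rewrite mulSn root_angleD cosD.
have eT : T = sin x * S + cos x * T.
  rewrite -[LHS](shift (fun k => sin (root_angle R n (k * m)))); last first.
    by rewrite -[(n * m)%N]add0n mulnC root_angleD sin_root_angle_periodic.
  rewrite !mulr_sumr -big_split; apply: eq_bigr => k _.
  by rewrite mulSn root_angleD sinD.
have cx : 0 < 1 - cos x.
  by rewrite subr_gt0 lt_neqAle cos_le1 cos_root_angle_neq1.
have sc : sin x ^+ 2 = 1 - cos x ^+ 2 by rewrite sin2cos2.
have S0 : 2 * (1 - cos x) * S = 0.
  have -> : 2 * (1 - cos x) * S = (1 - cos x) * ((1 - cos x) * S) +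
     (1 - cos x ^+ 2) * S by ring.
  have -> : (1 - cos x) * S = - sin x * T by lra.
  rewrite -sc.
  have : sin x * ((1 - cos x) * T) = sin x * (sin x * S).
    by congr (_ * _); lra.
  by move=> h; lra.
have {}S0 : S = 0 by apply/eqP; move/eqP: S0; rewrite !mulf_eq0 pnatr_eq0 (gt_eqF cx).
split=> //; apply/eqP; move: eT; rewrite S0 mulr0 add0r => eT.
have : (1 - cos x) * T = 0 by lra.
by move/eqP; rewrite mulf_eq0 (gt_eqF cx).
Qed.

Lemma abel_decreasing_ge (R : realType) (N : nat) (G b : nat -> R) :
  (forall m, (m < N)%N -> G m.+1 <= G m) ->
  (forall m, (m < N)%N -> 0 <= \sum_(0 <= l < m.+1) b l) ->
  G N * \sum_(0 <= l < N.+1) b l <= \sum_(0 <= l < N.+1) G l * b l.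
Proof.
elim: N => [|N IH] Gd Bge; first by rewrite !big_nat1.
rewrite big_nat_recr //= [leRHS]big_nat_recr //= mulrDr lerD2r.
apply: le_trans (IH _ _) => [|m mN|m mN]; last 2 first.
- by apply: Gd; apply: ltnW.
- by apply: Bge; apply: ltnW.
by apply: ler_wpM2r; [apply: Bge|apply: Gd].
Qed.

(** [G] is replaced by [K], the maximum of its later values: this is nonincreasing and exceeds [G]
    by at most [eps]. Exact Abel summation applies to [K], its boundary term vanishes with the total
    of [b], and the replacement costs [eps] times the sum of the absolute values of [b]. *)
Lemma abel_almost_decreasing_ge (R : realType) (N : nat) (G b : nat -> R)
    (eps : R) : 0 <= eps ->
  (forall m l, (m <= l <= N)%N -> G l - eps <= G m) ->
  (forall m, (m < N)%N -> 0 <= \sum_(0 <= l < m.+1) b l) ->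
  \sum_(0 <= l < N.+1) b l = 0 ->
  - (eps * \sum_(0 <= l < N.+1) `|b l|) <= \sum_(0 <= l < N.+1) G l * b l.
Proof.
move=> eps0 Gd Bge B0.
pose K m := \big[Num.max/G N]_(m <= l < N.+1) G l.
have KS m : (m <= N)%N -> K m = Num.max (G m) (K m.+1).
  by move=> mN; rewrite /K big_ltn.
have K1 m : (m <= N)%N -> G m <= K m by move=> mN; rewrite KS // le_max lexx.
have K2 m : (m <= N)%N -> K m <= G m + eps.
  move=> mN; rewrite /K big_nat.
  apply: (big_ind (fun z => z <= G m + eps)) => [|y z hy hz|l ml].
  - by rewrite -lerBlDr Gd // mN leqnn.
  - by rewrite ge_max hy hz.
  - by rewrite -lerBlDr Gd // -ltnS.
have Kd m : (m < N)%N -> K m.+1 <= K m.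
  by move=> mN; rewrite [leRHS]KS 1?ltnW // le_max lexx orbT.
have := abel_decreasing_ge Kd Bge; rewrite B0 mulr0 => h.
rewrite -[leLHS]add0r; apply: le_trans (lerD h (lexx _)) _.
rewrite mulr_sumr -sumrN -big_split /= big_nat [leRHS]big_nat.
apply: ler_sum => l /andP[_ lN].
have : `|(K l - G l) * b l| <= eps * `|b l|.
  rewrite normrM ler_wpM2r // ger0_norm ?subr_ge0 ?K1 //.
  by rewrite lerBlDl K2.
by move=> /(le_trans (ler_norm _)); rewrite mulrBl; lra.
Qed.

(** * The discrete Fourier transform and the Hartley basis *)

Section DiscreteFourier.
Variables (R : realType) (n : nat) (g : R -> R).
Hypothesis n_gt0 : (0 < n)%N.

Local Notation ang := (root_angle R n).
Local Notation G m := (fold_ext g (ang m)).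

Lemma root_angleBn (k l : nat) (x : R) : (l <= n)%N ->
  cos (x + ang (k * (n - l))) = cos (x - ang (k * l)) /\
  sin (x + ang (k * (n - l))) = sin (x - ang (k * l)).
Proof.
move=> ln.
have -> : x + ang (k * (n - l)) = x - ang (k * l) + ang (k * n).
  have -> : ang (k * n) = ang (k * (n - l)) + ang (k * l).
    by rewrite -root_angleD -mulnDr subnK.
  by ring.
by rewrite cos_root_angle_periodic // sin_root_angle_periodic.
Qed.

Lemma fold_ext_sym (m : nat) : (m <= n)%N -> (0 < m)%N -> G (n - m) = G m.
Proof.
move=> mn m0; have -> : ang (n - m) = 2 * pi - ang m.
  rewrite /root_angle natrB //; field.
  by rewrite pnatr_eq0 -lt0n.
rewrite /fold_ext; case: (leP (ang m) pi) => h1; case: leP => h2 //.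
- by congr g; lra.
- by congr g; lra.
- by exfalso; lra.
Qed.

Lemma dft_root_angle (k : nat) :
  dft n g k = \sum_(0 <= m < n) G m * cos (ang (m * k)).
Proof.
rewrite /dft; apply: eq_bigr => m _; congr (_ * cos _).
by rewrite /root_angle natrM; ring.
Qed.

Lemma dft_sym (k : nat) : (k <= n)%N -> dft n g (n - k) = dft n g k.
Proof.
move=> kn; rewrite !dft_root_angle; apply: eq_bigr => m _; congr (_ * _).
by rewrite -[ang _]add0r (root_angleBn _ _ kn).1 sub0r cosN.
Qed.

Lemma dft_le_dft0 (k : nat) : (forall m, (m < n)%N -> 0 <= G m) ->
  dft n g k <= dft n g 0.
Proof.
move=> G0; rewrite !dft_root_angle; apply: ler_sum_nat => m /andP[_ mn].
have -> : cos (ang (m * 0)) = 1 by rewrite muln0 /root_angle mulr0 mul0r cos0.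
by rewrite ler_wpM2l ?cos_le1 ?G0.
Qed.

Lemma dft_norm_le (k : nat) : (forall m, (m < n)%N -> 0 <= G m <= 1) ->
  `|dft n g k| <= n%:R.
Proof.
move=> G01; rewrite dft_root_angle; apply: le_trans (ler_norm_sum _ _ _) _.
rewrite -[leRHS](_ : \sum_(0 <= m < n) 1 = _); last by rewrite sumr_const_nat subn0.
apply: ler_sum_nat => m /andP[_ /G01/andP[g0 g1]].
by rewrite normrM (ger0_norm g0) mulr_ile1 // cos_max.
Qed.

Lemma sum_dft_cos (l : nat) : (l < n)%N ->
  \sum_(k < n) dft n g k * cos (ang (k * l)) = n%:R * G l.
Proof.
move=> ln.
(* Product-to-sum formula, with the frequency [m - l] represented modulo [n] by the natural number
   [m + (n - l)]. *)
have -> : \sum_(k < n) dft n g k * cos (ang (k * l)) =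
    \sum_(m < n) G m / 2 * (\sum_(k < n) cos (ang (k * (m + l))) +
                            \sum_(k < n) cos (ang (k * (m + (n - l))))).
  transitivity (\sum_(k < n) \sum_(m < n) G m * cos (ang (m * k)) * cos (ang (k * l))).
    by apply: eq_bigr => k _; rewrite dft_root_angle big_mkord mulr_suml.
  rewrite exchange_big; apply: eq_bigr => m _ /=.
  rewrite -big_split mulr_sumr; apply: eq_bigr => k _ /=.
  rewrite !mulnDr !root_angleD (root_angleBn _ _ (ltnW ln)).1 cosD cosB.
  by rewrite (mulnC m k); field.
have dvd1 (m : 'I_n) : (n %| m + (n - l))%N = (m == Ordinal ln).
  apply/idP/eqP => [/dvdnP[q hq]|->]; last by rewrite /= subnKC 1?ltnW.
  apply: val_inj => /=; have mn := ltn_ord m.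
  have [q0|[q1|[q2|q3]]] : (q = 0 \/ q = 1 \/ q = 2 \/ 2 < q)%N by lia.
  - by move: hq; rewrite q0; lia.
  - by move: hq; rewrite q1; lia.
  - by move: hq; rewrite q2; lia.
  - by move: hq; nia.
under eq_bigr => m _ do rewrite !(sum_cos_sin_root_angle _ _ n_gt0).1 dvd1.
(* For [l = 0] both indicators select [m = 0]; otherwise they select [l] and [n - l], which
   contribute half each because the folded function is even. *)
have [l0|l0] := posnP l.
  rewrite (bigD1 (Ordinal ln)) //= big1 ?addr0 => [|m mN]; last first.
    rewrite (negPf mN) l0 addn0 gtnNdvd ?ltn_ord ?addr0 ?mulr0 // lt0n.
    by apply: contra mN => m0; apply/eqP/val_inj; rewrite /= l0; apply/eqP.
  by rewrite eqxx l0 addn0 dvdn0; field.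
have lN : (n - l < n)%N by lia.
have dvd2 (m : 'I_n) : (n %| m + l)%N = (m == Ordinal lN).
  apply/idP/eqP => [/dvdnP[q hq]|->]; last by rewrite /= subnK 1?ltnW.
  apply: val_inj => /=; have mn := ltn_ord m.
  have [q0|[q1|q2]] : (q = 0 \/ q = 1 \/ 1 < q)%N by lia.
  - by move: hq; rewrite q0; lia.
  - by move: hq; rewrite q1; lia.
  - by move: hq; nia.
under eq_bigr => m _ do rewrite dvd2 mulrDr.
rewrite big_split /= (bigD1 (Ordinal lN)) //=.
rewrite big1 => [|m /negPf ->]; last by rewrite mulr0.
rewrite (bigD1 (Ordinal ln)) //= big1 => [|m /negPf ->]; last by rewrite mulr0.
by rewrite !eqxx fold_ext_sym // 1?ltnW //; field.
Qed.

Lemma sum_dft_sin (l : nat) : (l < n)%N ->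
  \sum_(k < n) dft n g k * sin (ang (k * l)) = 0.
Proof.
move=> ln; transitivity (\sum_(m < n) G m / 2 *
    (\sum_(k < n) sin (ang (k * (m + l))) -
     \sum_(k < n) sin (ang (k * (m + (n - l)))))); last first.
  by rewrite big1 // => m _; rewrite !(sum_cos_sin_root_angle _ _ n_gt0).2 subrr mulr0.
transitivity (\sum_(k < n) \sum_(m < n) G m * cos (ang (m * k)) * sin (ang (k * l))).
  by apply: eq_bigr => k _; rewrite dft_root_angle big_mkord mulr_suml.
rewrite exchange_big; apply: eq_bigr => m _ /=.
rewrite -sumrB mulr_sumr; apply: eq_bigr => k _ /=.
rewrite !mulnDr !root_angleD (root_angleBn _ _ (ltnW ln)).2 sinD sinB.
by rewrite (mulnC m k); field.
Qed.

(** The kernel of the Hartley transform. A product of two of its values is a cosine of the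
    difference plus a sine of the sum, and the sine part vanishes after summation over the
    frequency. *)
Definition cas (m : nat) : R := cos (ang m) + sin (ang m).

Lemma casM (k a b : nat) : (b <= a)%N ->
  cas (k * a) * cas (k * b) = cos (ang (k * (a - b))) + sin (ang (k * (a + b))).
Proof.
move=> ba; rewrite /cas mulnDr root_angleD.
have -> : ang (k * (a - b)) = ang (k * a) - ang (k * b).
  by rewrite -{2}(subnK ba) mulnDr root_angleD addrK.
by rewrite cosB sinD; ring.
Qed.

Lemma sum_casM (a b : nat) : (0 < a <= n)%N -> (0 < b <= n)%N ->
  \sum_(k < n) cas (k * a) * cas (k * b) = (a == b)%:R * n%:R.
Proof.
wlog ba : a b / (b <= a)%N.
  move=> hw ha hb; have [?|ab] := leqP b a; first exact: hw.
  rewrite eq_sym -(hw b a) ?(ltnW ab) //.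
  by apply: eq_bigr => k _; rewrite mulrC.
move=> /andP[a0 an] /andP[b0 bn].
rewrite (eq_bigr (fun k : 'I_n => cos (ang (k * (a - b))) + sin (ang (k * (a + b))))).
  rewrite big_split /= (sum_cos_sin_root_angle _ _ n_gt0).1.
  rewrite (sum_cos_sin_root_angle _ _ n_gt0).2 addr0.
  have [->|abN] := eqVneq a b; first by rewrite subnn dvdn0 mul1r.
  by rewrite gtnNdvd ?mul0r //; lia.
by move=> k _; apply: casM.
Qed.

Lemma sum_dft_sin_mod (l : nat) :
  \sum_(k < n) dft n g k * sin (ang (k * l)) = 0.
Proof.
rewrite -[RHS](@sum_dft_sin (l %% n)) ?ltn_mod //; apply: eq_bigr => k _; congr (_ * _).
rewrite {1}(divn_eq l n) mulnDr addnC root_angleD mulnA.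
by rewrite sin_root_angle_periodic.
Qed.

Lemma sum_dft_casM (a b : nat) : (0 < a <= n)%N -> (0 < b <= n)%N ->
  (b <= a)%N ->
  \sum_(k < n) dft n g k * (cas (k * a) * cas (k * b)) = n%:R * G (a - b).
Proof.
move=> /andP[a0 an] /andP[b0 bn] ba; rewrite -sum_dft_cos; last by lia.
rewrite -[RHS]addr0 -[X in _ = _ + X](sum_dft_sin_mod (a + b)) -big_split /=.
by apply: eq_bigr => k _; rewrite casM // mulrDr.
Qed.
End DiscreteFourier.

(** Reflection pairs each interior index with its mirror image and leaves 0 and [q] with weight one.
    It brings sums to the half period, where [g] is almost monotone. *)
Lemma sum_fold_even (R : realType) (q : nat) (F : nat -> R) : (0 < q)%N ->
  (forall m, (0 < m < q)%N -> F (2 * q - m)%N = F m) ->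
  \sum_(0 <= m < 2 * q) F m =
  \sum_(0 <= m < q.+1) (if (0 < m < q)%N then 2 else 1) * F m.
Proof.
move=> q0 Fsym.
rewrite (big_cat_nat (n := q)) //=; last by lia.
rewrite [X in X + _]big_ltn // [X in _ + X]big_ltn; last by lia.
rewrite [RHS]big_nat_recr //= [X in _ = X + _]big_ltn // !mul1r ltnn andbF mul1r.
have -> : \sum_(q.+1 <= i < 2 * q) F i = \sum_(1 <= i < q) F i.
  have -> : \sum_(q.+1 <= i < 2 * q) F i = \sum_(1 <= i < q) F (i + q)%N.
    by rewrite -{1}add1n big_addn; congr bigop; congr index_iota; lia.
  rewrite big_nat_rev [LHS]big_nat [RHS]big_nat; apply: eq_bigr => i hi.
  by rewrite -(Fsym i hi); congr F; lia.
have -> : \sum_(1 <= i < q) (if (0 < i < q)%N then 2 else 1) * F i =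
    2 * \sum_(1 <= i < q) F i.
  rewrite mulr_sumr [LHS]big_nat [RHS]big_nat; apply: eq_bigr => i hi.
  by rewrite [(0 < i < q)%N]hi.
by ring.
Qed.

Lemma dft_le_dft1 (R : realType) (q k : nat) (g : R -> R) (eps : R) :
  (2 <= q)%N -> (0 < k <= q)%N -> 0 <= eps ->
  (forall m l, (m <= l <= q)%N ->
    fold_ext g (root_angle R (2 * q) l) - eps <=
    fold_ext g (root_angle R (2 * q) m)) ->
  dft (2 * q) g k <= dft (2 * q) g 1 + 2 * (2 * q)%:R * eps.
Proof.
move=> q2 /andP[k0 kq] eps0 Gd.
set n := (2 * q)%N in Gd *; have n0 : (0 < n)%N by lia.
pose G m := fold_ext g (root_angle R n m).
(* After folding, these weights satisfy both conditions of almost monotone Abel summation: their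
   total vanishes since nonzero frequencies sum to zero over a period, and their partial sums are
   twice a difference of Dirichlet kernels. *)
pose a m : R := cos (root_angle R n (m * 1)) - cos (root_angle R n (m * k)).
pose b m : R := (if (0 < m < q)%N then 2 else 1) * a m.
have asym m : (0 < m < q)%N -> a (n - m)%N = a m.
  move=> /andP[m0 mq]; have mn : (m <= n)%N by lia.
  have cs l : cos (root_angle R n ((n - m) * l)) = cos (root_angle R n (m * l)).
    rewrite mulnC -[root_angle _ _ _]add0r (root_angleBn n0 _ _ mn).1.
    by rewrite sub0r cosN mulnC.
  by rewrite /a !cs.
have a0 : a 0%N = 0 by rewrite /a !mul0n subrr.
have diff : dft n g 1 - dft n g k = \sum_(0 <= m < q.+1) G m * b m.
  rewrite !dft_root_angle -sumrB.
  under eq_bigr => m _ do rewrite -mulrBr.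
  rewrite (@sum_fold_even _ _ (fun m => G m * a m)) //; last 2 first.
  - by lia.
  - move=> m hm; rewrite asym // /G fold_ext_sym //; lia.
  by apply: eq_bigr => m _; rewrite /b mulrCA.
have total : \sum_(0 <= m < q.+1) b m = 0.
  rewrite -(@sum_fold_even _ _ a) //; last by lia.
  have sc l : (0 < l <= q)%N -> \sum_(0 <= m < n) cos (root_angle R n (m * l)) = 0.
    move=> hl; rewrite big_mkord (sum_cos_sin_root_angle _ _ n0).1 gtnNdvd //; lia.
  by rewrite sumrB !sc ?subrr //; lia.
have partial m : (m < q)%N -> 0 <= \sum_(0 <= l < m.+1) b l.
  move=> mq; rewrite big_ltn // {1}/b a0 mulr0 add0r.
  have -> : \sum_(1 <= l < m.+1) b l = 2 * \sum_(1 <= l < m.+1) a l.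
    rewrite mulr_sumr [LHS]big_nat [RHS]big_nat; apply: eq_bigr => l hl.
    by rewrite /b ifT //; lia.
  rewrite mulr_ge0 // /a sumrB subr_ge0.
  have := @dirichlet_kernel_le R n m k n0 _ k0 _.
  have h1 : (2 * m + 1 < n)%N by lia.
  have h2 : (2 * k <= n)%N by lia.
  move=> /(_ h1 h2).
  have e l r : l%:R * (2 * (r%:R * (pi / n%:R))) = root_angle R n (l * r).
    by rewrite /root_angle natrM; ring.
  have e1 l : l%:R * (2 * (pi / n%:R)) = root_angle R n (l * 1).
    by rewrite -e mul1r.
  by under eq_bigr => l _ do rewrite e; under [leRHS]eq_bigr => l _ do rewrite e1.
have := abel_almost_decreasing_ge eps0 (Gd : forall m l, _ -> G l - eps <= G m)
  partial total.
have : \sum_(0 <= l < q.+1) `|b l| <= 2 * n%:R.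
  have -> : 2 * n%:R = \sum_(0 <= m < n) 2 :> R.
    by rewrite sumr_const_nat subn0 mulr_natr.
  rewrite (@sum_fold_even _ q (fun=> 2)) //; last by lia.
  apply: ler_sum => l _; rewrite /b normrM ger0_norm; last by case: ifP.
  apply: ler_wpM2l; first by case: ifP.
  by apply: le_trans (ler_normB _ _) _; rewrite (_ : 2 = 1 + 1) ?lerD ?cos_max //; lra.
rewrite -diff => h1 h2.
have : eps * \sum_(0 <= l < q.+1) `|b l| <= eps * (2 * n%:R) by rewrite ler_wpM2l.
lra.
Qed.

(** * The circle and regular tuples *)

Lemma cos_sin_eq_small (R : realType) (t u : R) :
  `|t - u| < 2 * pi -> cos t = cos u -> sin t = sin u -> t = u.
Proof.
move=> tu ct st; have : cos (t - u) = 1.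
  by rewrite cosB ct st -!expr2 cos2Dsin2.
set h := (t - u) / 2; have -> : t - u = h *+ 2 by rewrite -mulr_natr divfK.
have {}tu : `|h| < pi.
  by rewrite /h normrM (@ger0_norm _ 2^-1) // ltr_pdivrMr // mulrC.
rewrite cos_mulr2n cos2sin2 mulr2n => e.
have : sin `|h| ^+ 2 = 0.
  have [h0|h0] := leP 0 h; first by rewrite ger0_norm //; lra.
  by rewrite ltr0_norm // sinN sqrrN; lra.
move/eqP; rewrite sqrf_eq0 => /eqP s0.
have [h0|hN] := eqVneq h 0.
  apply/eqP; rewrite -subr_eq0; move/eqP: h0.
  by rewrite /h mulf_eq0 invr_eq0 pnatr_eq0 orbF.
have : 0 < sin `|h| by apply: sin_gt0_pi; rewrite normr_gt0 hN.
by rewrite s0 ltxx.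
Qed.

Lemma cexp_surj (R : realType) (x : circle R) :
  exists2 t : R, 0 <= t < 2 * pi & cexp t = x.
Proof.
case: x => -[a b] /= ab; have pi0 := pi_gt0 R.
have e : a ^+ 2 + b ^+ 2 = 1 by apply/eqP.
have a2 : a ^+ 2 <= 1 by have := sqr_ge0 b; lra.
have a1 : -1 <= a <= 1.
  by rewrite -ler_norml -(@ler_pXn2r _ 2) ?nnegrE // expr1n real_normK ?num_real.
have sb : Num.sqrt (1 - a ^+ 2) = `|b|.
  by rewrite (_ : 1 - a ^+ 2 = b ^+ 2) ?sqrtr_sqr //; lra.
have c0 := acos_ge0 a1; have cpi := acos_lepi a1.
have [b0|b0] := lerP 0 b.
  exists (acos a); first by apply/andP; split; lra.
  apply: val_inj => /=; rewrite acosK ?in_itv //= sin_acos // sb ger0_norm //.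
have a_lt1 : a < 1.
  rewrite lt_neqAle; case/andP: a1 => _ ->; rewrite andbT.
  apply/eqP => a_1; move: e; rewrite a_1 expr1n => e.
  have : 0 < b ^+ 2 by rewrite exprn_even_gt0 //= lt_eqF.
  by lra.
have c_gt0 : 0 < acos a by apply: acos_gt0; case/andP: a1 => -> _.
exists (- acos a + pi *+ 2).
  by apply/andP; split; rewrite mulr2n; lra.
apply: val_inj => /=; rewrite cosD2pi sinD2pi cosN sinN.
by rewrite acosK ?in_itv //= sin_acos // sb ltr0_norm // opprK.
Qed.

Lemma carg_spec (R : realType) (x : circle R) :
  0 <= carg x < 2 * pi /\ cexp (carg x) = x.
Proof.
have [t t_itv tx] := cexp_surj x.
by apply: (@xgetPex _ 0 ([set t : R | 0 <= t < 2 * pi /\ cexp t = x])); exists t.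
Qed.

Lemma cexpK (R : realType) (t : R) : 0 <= t < 2 * pi -> carg (cexp t) = t.
Proof.
move=> ht; have [h e] := carg_spec (cexp t).
apply: cos_sin_eq_small; last 2 first.
- by have := congr1 (fun z : circle R => (val z).1) e.
- by have := congr1 (fun z : circle R => (val z).2) e.
move/andP: h => [h1 h2]; move/andP: ht => [h3 h4].
by rewrite ltr_norml; apply/andP; split; lra.
Qed.

Lemma carg_cexp2pi (R : realType) : carg (cexp (2 * pi : R)) = 0.
Proof.
have -> : cexp (2 * pi) = cexp 0 :> circle R.
  apply: val_inj => /=; rewrite mulr_natl.
  by rewrite -[pi *+ 2]add0r cosD2pi sinD2pi.
by apply: cexpK; rewrite lexx mulr_gt0 // pi_gt0.
Qed.

(** The right endpoint is included because the labels of a regular tuple run up to [n], whose angle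
    is 2 pi while its [carg] is 0; the minimum is unchanged by this jump. *)
Lemma cdist_cexp (R : realType) (a b : R) : 0 <= a <= 2 * pi -> 0 <= b <= 2 * pi ->
  cdist (cexp a) (cexp b) = Num.min `|a - b| (2 * pi - `|a - b|).
Proof.
have pi0 := pi_gt0 R.
move=> /andP[a0 a1] /andP[b0 b1]; rewrite /cdist.
have [a2|a2] := ltP a (2 * pi); last first.
  have -> : a = 2 * pi by apply/le_anti; rewrite a1.
  rewrite carg_cexp2pi; have [b2|b2] := ltP b (2 * pi).
    rewrite cexpK ?b0 // sub0r normrN ger0_norm // ger0_norm; last by lra.
    by rewrite minC; congr Num.min; lra.
  have -> : b = 2 * pi by apply/le_anti; rewrite b1.
  by rewrite carg_cexp2pi !subrr.
rewrite (cexpK (t := a)) ?a0 //; have [b2|b2] := ltP b (2 * pi).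
  by rewrite cexpK ?b0.
have -> : b = 2 * pi by apply/le_anti; rewrite b1.
rewrite carg_cexp2pi subr0 ger0_norm // distrC ger0_norm; last by lra.
by rewrite minC; congr Num.min; lra.
Qed.

Lemma cdistC (R : realType) (x y : circle R) : cdist x y = cdist y x.
Proof. by rewrite /cdist distrC. Qed.

Lemma cos_lipschitz (R : realType) (a b : R) : `|cos a - cos b| <= `|a - b|.
Proof.
wlog ab : a b / a <= b.
  move=> hw; have [?|/ltW?] := leP a b; first exact: hw.
  by rewrite distrC [leRHS]distrC hw.
have [|c _ e] := @MVT_segment R cos (fun x => - sin x) a b ab.
  by apply: continuous_subspaceT => x; apply: continuous_cos.
by rewrite distrC e normrM normrN (distrC b) ler_piMl // sin_max.
Qed.

Lemma sin_lipschitz (R : realType) (a b : R) : `|sin a - sin b| <= `|a - b|.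
Proof.
rewrite -!cosBpihalf (le_trans (cos_lipschitz _ _)) //.
by rewrite opprB addrA subrK.
Qed.

Lemma circle_coord_lipschitz (R : realType) (x y : circle R) :
  `|(val x).1 - (val y).1| <= cdist x y /\ `|(val x).2 - (val y).2| <= cdist x y.
Proof.
have [/andP[x0 x1] ex] := carg_spec x; have [/andP[y0 y1] ey] := carg_spec y.
rewrite -{1 3}ex -{1 3}ey /cdist /=; move: (carg x) (carg y) x0 x1 y0 y1 => a b.
move=> a0 a1 b0 b1; rewrite !le_min cos_lipschitz sin_lipschitz /=.
have main (t u : R) : 0 <= t -> t <= u -> u < 2 * pi ->
    `|cos t - cos u| <= 2 * pi - `|t - u| /\ `|sin t - sin u| <= 2 * pi - `|t - u|.
  move=> t0 tu u1; rewrite -(cosD2pi t) -(sinD2pi t).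
  have -> : 2 * pi - `|t - u| = `|t + pi *+ 2 - u|.
    rewrite distrC ger0_norm ?subr_ge0 // ger0_norm; rewrite mulr2n; lra.
  by rewrite cos_lipschitz sin_lipschitz.
have [ab|/ltW ba] := leP a b; first exact: main.
by rewrite distrC [`|a - b|]distrC [`|sin a - _|]distrC; apply: main.
Qed.

Lemma fold_ext_min (R : realType) (g : R -> R) (t : R) :
  g (Num.min t (2 * pi - t)) = fold_ext g t.
Proof.
by rewrite /fold_ext; case: (leP t pi) => h; congr g; rewrite /Num.min;
  case: ifP => // h'; lra.
Qed.

Lemma root_angle_ge0 (R : realType) (n m : nat) : 0 <= root_angle R n m.
Proof. by rewrite /root_angle !mulr_ge0 ?invr_ge0 ?ler0n ?pi_ge0. Qed.

Lemma root_angle_le (R : realType) (n m l : nat) : (m <= l)%N ->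
  root_angle R n m <= root_angle R n l.
Proof.
move=> ml; rewrite /root_angle ler_wpM2r ?invr_ge0 ?ler0n //.
by rewrite ler_wpM2l ?ler_nat // mulr_ge0 ?pi_ge0.
Qed.

Lemma root_angle_half (R : realType) (q : nat) : (0 < q)%N ->
  root_angle R (2 * q) q = pi.
Proof. by move=> q0; rewrite /root_angle natrM; field; rewrite pnatr_eq0 -lt0n. Qed.

Lemma root_angle_2pi (R : realType) (n : nat) : (0 < n)%N ->
  root_angle R n n = 2 * pi.
Proof. by move=> n0; rewrite /root_angle mulfK // pnatr_eq0 -lt0n. Qed.

Section Regular.
Variables (R : realType) (n : nat) (f : circle R -> circle R -> R) (g : R -> R).
Hypothesis fg : forall y z, f y z = g (cdist y z).

(** Seen from the point of angle 0, every angle up to pi is its own distance, so the lower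
    inequality of [BL] compares two values of [g]; its term in [cl] is nonnegative and is
    dropped. *)
Lemma BL_fold_almost_decreasing (q : nat) (cl cL ce : R) (m l : nat) :
  n = (2 * q)%N -> (0 < q)%N -> 0 <= cl -> BL cl cL ce n f -> (m <= l <= q)%N ->
  fold_ext g (root_angle R n l) - BLeps ce n <= fold_ext g (root_angle R n m).
Proof.
move=> nE q0 cl0 [_ _ _ fmono] /andP[ml lq].
have pi0 := pi_gt0 R.
have lpi : root_angle R n l <= pi by rewrite -(root_angle_half R q0) nE root_angle_le.
have mlR := root_angle_le R n ml.
have m0 := root_angle_ge0 R n m.
have d0 k : 0 <= root_angle R n k <= pi ->
    cdist (cexp 0) (cexp (root_angle R n k)) = root_angle R n k.
  move=> /andP[k0 k1]; rewrite cdist_cexp; last 2 first.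
  - by rewrite lexx /=; lra.
  - by apply/andP; split; lra.
  rewrite sub0r normrN ger0_norm // /Num.min; case: ltP => //; lra.
have := fmono (cexp 0) (cexp (root_angle R n l)) (cexp (root_angle R n m)).
rewrite !fg !d0 ?m0 ?(le_trans m0 mlR) ?(le_trans mlR lpi) //= => /(_ mlR).
rewrite /fold_ext lpi (le_trans mlR lpi) => h.
have : 0 <= cl * (root_angle R n l - root_angle R n m).
  by rewrite mulr_ge0 // subr_ge0.
lra.
Qed.

Lemma fold_ext_bounds (m : nat) : (m <= n)%N -> (0 < n)%N ->
  (forall t : R, 0 <= t <= pi -> 0 <= g t <= 1) ->
  0 <= fold_ext g (root_angle R n m) <= 1.
Proof.
move=> mn n0 g01; have h := root_angle_le R n mn.
rewrite (root_angle_2pi R n0) in h; have h0 := root_angle_ge0 R n m.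
rewrite /fold_ext; case: (leP (root_angle R n m) pi) => h'; apply: g01;
  by apply/andP; split; lra.
Qed.

Lemma affinity_regular (y : 'I_n -> circle R) (p : 'I_n -> nat) (i j : 'I_n) :
  (0 < n)%N -> (forall k, (p k <= n)%N) ->
  (forall k, y k = cexp (root_angle R n (p k))) -> (p j <= p i)%N ->
  affinity_mx f y i j = fold_ext g (root_angle R n (p i - p j)).
Proof.
move=> n0 pn yp pij.
have e : `|root_angle R n (p i) - root_angle R n (p j)| = root_angle R n (p i - p j).
  rewrite -{1}(subnK pij) root_angleD addrK ger0_norm //.
  exact: root_angle_ge0.
rewrite /affinity_mx mxE fg !yp cdist_cexp ?e ?fold_ext_min //;
  by rewrite root_angle_ge0 -(root_angle_2pi R n0) root_angle_le.
Qed.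

(* Unlike the pairs cos, sin, the functions [cas] give a real orthonormal
   eigenbasis by a single formula, because [dft n g k = dft n g (n - k)]. *)
Definition hartley_mx (p : 'I_n -> nat) : 'M[R]_n :=
  \matrix_(k, j) (cas R n (k * p j) / Num.sqrt n%:R).

Lemma hartley_ortho (p : 'I_n -> nat) : (0 < n)%N ->
  (forall k, (0 < p k <= n)%N) -> injective p ->
  hartley_mx p *m (hartley_mx p)^T = 1%:M.
Proof.
(* Orthonormality is checked on the columns: the sum then runs over all frequencies, and [p] enters
   only through its injectivity. *)
move=> n0 pn pI; apply: mulmx1C; apply/matrixP => i j; rewrite !mxE.
have nR : n%:R != 0 :> R by rewrite pnatr_eq0 -lt0n.
transitivity (n%:R^-1 * \sum_(k < n) cas R n (k * p i) * cas R n (k * p j)).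
  rewrite mulr_sumr; apply: eq_bigr => k _; rewrite !mxE.
  rewrite mulrACA -invfM -expr2 sqr_sqrtr ?ler0n // mulrC.
  by [].
by rewrite sum_casM // (inj_eq pI) mulrCA mulVf // mulr1.
Qed.

Lemma affinity_hartley (y : 'I_n -> circle R) (p : 'I_n -> nat) :
  (0 < n)%N -> (forall k, (0 < p k <= n)%N) ->
  (forall k, y k = cexp (root_angle R n (p k))) ->
  affinity_mx f y =
  (hartley_mx p)^T *m diag_mx (\row_k dft n g k) *m hartley_mx p.
Proof.
move=> n0 pn yp; apply/matrixP => i j.
have nR : n%:R != 0 :> R by rewrite pnatr_eq0 -lt0n.
have pn' k : (p k <= n)%N by case/andP: (pn k).
rewrite mul_mx_diag mxE.
transitivity (n%:R^-1 * \sum_(k < n) dft n g k * (cas R n (k * p i) * cas R n (k * p j)));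
  last first.
  rewrite mulr_sumr mxE; apply: eq_bigr => k _; rewrite !mxE.
  have <- : (Num.sqrt n%:R)^-1 * (Num.sqrt n%:R)^-1 = n%:R^-1 :> R.
    by rewrite -invfM -expr2 sqr_sqrtr ?ler0n.
  by ring.
wlog pij : i j / (p j <= p i)%N.
  move=> hw; have [?|/ltnW ?] := leqP (p j) (p i); first exact: hw.
  have -> : f (y i) (y j) = f (y j) (y i) by rewrite !fg cdistC.
  by rewrite hw //; congr (_ * _); apply: eq_bigr => k _; rewrite [cas _ _ _ * _]mulrC.
have := affinity_regular n0 pn' yp pij; rewrite mxE => ->.
by rewrite sum_dft_casM // mulKf.
Qed.
End Regular.

(** * The noise *)

Lemma probability_bigsetU_le (R : realType) (d : measure_display)
    (T : measurableType d) (P : probability T R) (I : Type) (s : seq I)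
    (A : I -> set T) (e : R) :
  (forall i, measurable (A i)) -> (forall i, (P (A i) <= e%:E)%E) ->
  measurable (\big[setU/set0]_(i <- s) A i) /\
  (P (\big[setU/set0]_(i <- s) A i) <= ((size s)%:R * e)%:E)%E.
Proof.
move=> mA Ae; elim: s => [|i s [mU IH]].
  by rewrite big_nil measure0 mul0r; split.
rewrite big_cons; split; first exact: measurableU.
apply: le_trans (measureU2 P (mA i) mU) _.
by rewrite /= -natr1 mulrDl mul1r addrC EFinD leeD.
Qed.

Definition pair_sum (R : realType) (n : nat) (F : 'I_n -> 'I_n -> R) : R :=
  \sum_(i < n) \sum_(j < n | (i < j)%N) F i j.

Lemma ler_norm_pair_sum (R : realType) (n : nat) (F : 'I_n -> 'I_n -> R) (c : R) :
  0 <= c -> (forall i j : 'I_n, (i < j)%N -> `|F i j| <= c) ->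
  `|pair_sum F| <= n%:R ^+ 2 * c.
Proof.
move=> c0 Fc; rewrite /pair_sum (le_trans (ler_norm_sum _ _ _)) //.
have -> : n%:R ^+ 2 * c = \sum_(i < n) \sum_(j < n) c.
  by rewrite !sumr_const !card_ord -mulrnA -[in RHS]mulr_natl natrM expr2.
apply: ler_sum => i _; rewrite (le_trans (ler_norm_sum _ _ _)) //.
rewrite big_mkcond; apply: ler_sum => j _.
by case: ifP => // ij; apply: Fc.
Qed.

Lemma pair_sum_indicator (R : realType) (n : nat) (F : 'I_n -> 'I_n -> R)
    (i0 j0 : 'I_n) (v : 'I_n -> R) : (i0 < j0)%N ->
  v i0 = 1 -> v j0 = 1 -> (forall k, k != i0 -> k != j0 -> v k = 0) ->
  pair_sum (fun i j => v i * v j * F i j) = F i0 j0.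
Proof.
move=> ij vi vj v0; rewrite /pair_sum (bigD1 i0) //= [X in _ + X]big1 ?addr0; last first.
  move=> i iN; apply: big1 => j ij'.
  have [iE|iN'] := eqVneq i j0; last by rewrite v0 // !mul0r.
  rewrite (v0 j) ?mulr0 ?mul0r // -val_eqE neq_ltn; apply/orP; right.
    by apply: ltn_trans ij' ; rewrite iE.
  by rewrite -iE.
rewrite (bigD1 j0) //= vi vj !mul1r [X in _ + X]big1 ?addr0 // => j /andP[ij' jN].
rewrite (v0 j) ?mulr0 ?mul0r // -val_eqE neq_ltn; apply/orP; right.
by [].
Qed.

Lemma pair_sum_sqr_le (R : realType) (n : nat) (v : 'I_n -> R) :
  pair_sum (fun i j => (v i * v j) ^+ 2) <= (\sum_i v i ^+ 2) ^+ 2.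
Proof.
rewrite /pair_sum expr2 mulr_suml; apply: ler_sum => i _.
rewrite mulr_sumr big_mkcond; apply: ler_sum => j _.
by rewrite exprMn; case: ifP => // _; rewrite mulr_ge0 ?sqr_ge0.
Qed.

(* The mesh n ^ -2 is so fine that a crude bound of the entries controls the
   discretization error; e_i + e_j lies on the grid, which bounds the entries. *)
Definition grid (R : realType) (n : nat) (h : {ffun 'I_n -> 'I_(2 * n ^ 2).+1})
    (i : 'I_n) : R := (h i)%:R / (n ^ 2)%:R - 1.
Arguments grid : clear implicits.

(** Rounding goes towards zero, so that the grid vector is no longer than the vector it
    approximates. *)
Lemma grid_approx (R : realType) (n : nat) (x : R) : (0 < n)%N -> `|x| <= 1 ->
  exists k : 'I_(2 * n ^ 2).+1,
    `|k%:R / (n ^ 2)%:R - 1| <= `|x| /\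
    `|x - (k%:R / (n ^ 2)%:R - 1)| <= (n ^ 2)%:R^-1.
Proof.
move=> n0 x1; set N := (n ^ 2)%N.
have N0 : 0 < N%:R :> R by rewrite ltr0n expn_gt0 n0.
pose m := Num.trunc (N%:R * `|x|).
have m_itv : m%:R <= N%:R * `|x| < m.+1%:R.
  by rewrite /m Num.Theory.truncn_itv // mulr_ge0 // ltW.
case/andP: m_itv => m1 m2; rewrite -natr1 in m2.
have mN : (m <= N)%N.
  by rewrite -(ler_nat R) (le_trans m1) // ler_piMr // ltW.
have d1 : m%:R / N%:R <= `|x| by rewrite ler_pdivrMr // mulrC.
have d0 : 0 <= m%:R / N%:R :> R by rewrite divr_ge0 // ltW.
have d2 : `|x| < m%:R / N%:R + N%:R^-1.
  by rewrite -[X in _ + X]mul1r -mulrDl ltr_pdivlMr // mulrC.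
have NN : N%:R / N%:R = 1 :> R by rewrite divff // gt_eqF.
have [x0|x0] := leP 0 x.
  have kP : (N + m < (2 * N).+1)%N by lia.
  exists (Ordinal kP) => /=; rewrite natrD mulrDl NN [1 + _]addrC addrK.
  rewrite ger0_norm //; split => //; move: d1 d2; rewrite ger0_norm // => d1 d2.
  by rewrite ger0_norm ?subr_ge0 //; lra.
have kP : (N - m < (2 * N).+1)%N by lia.
exists (Ordinal kP) => /=; rewrite natrB // mulrBl NN [1 - _]addrC addrK normrN.
rewrite ger0_norm //; split => //; move: d1 d2; rewrite ltr0_norm // => d1 d2.
by rewrite opprK ler_norml; apply/andP; split; lra.
Qed.

(** The grid with signs has 2 (2 n^2 + 1)^n <= n^(3 n + 1) elements, and the deviation 3 sqrt (n ln
    n) has tail exp (- 9/2 n ln n) <= n^(- 4 n). The product n^(1 - n) is at most n^(-2). *)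
Lemma noise_probability_bound (R : realType) (n : nat) : (4 <= n)%N ->
  2 * (2 * n ^ 2).+1%:R ^+ n *
    expR (- (3 * Num.sqrt (n%:R * ln n%:R)) ^+ 2 / 2) <= (n%:R ^+ 2)^-1 :> R.
Proof.
move=> n4; have nR : 1 <= n%:R :> R by rewrite ler1n; lia.
have n0 : 0 < n%:R :> R by lra.
have ln0 : 0 <= ln n%:R :> R by apply: ln_ge0.
have e_le : expR (- (3 * Num.sqrt (n%:R * ln n%:R)) ^+ 2 / 2) <=
    ((n ^ (4 * n))%:R)^-1 :> R.
  have -> : (n ^ (4 * n))%:R^-1 = expR (- ((4 * n)%:R * ln n%:R)) :> R.
    by rewrite expRN mulrC expRM_natr lnK ?posrE // natrX.
  rewrite ler_expR exprMn sqr_sqrtr ?mulr_ge0 ?ler0n // natrM.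
  have : 0 <= n%:R * ln n%:R :> R by rewrite mulr_ge0 ?ler0n.
  by rewrite -mulrA; lra.
apply: (@le_trans _ _ (2 * (2 * n ^ 2).+1%:R ^+ n * (n ^ (4 * n))%:R^-1)).
  by rewrite ler_wpM2l // mulr_ge0 // exprn_ge0.
rewrite ler_pdivrMr ?ltr0n ?expn_gt0; last by lia.
rewrite [leRHS]mulrC ler_pdivlMr ?exprn_gt0 // -!natrX -!natrM ler_nat.
have h1 : ((2 * n ^ 2).+1 <= n ^ 3)%N by rewrite !expnS expn0; nia.
have h2 : ((2 * n ^ 2).+1 ^ n <= n ^ (3 * n))%N.
  by rewrite expnM leq_exp2r //; lia.
apply: (@leq_trans (n ^ 1 * n ^ (3 * n) * n ^ 2)).
  by rewrite leq_mul2r leq_mul ?orbT // expn1; lia.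
by rewrite -!expnD leq_exp2l; lia.
Qed.

Lemma grid_bound_unit (R : realType) (n : nat) (F : 'I_n -> 'I_n -> R) (t : R) :
  (0 < n)%N -> 0 <= t ->
  (forall h, `|pair_sum (fun i j => grid R n h i * grid R n h j * F i j)| <=
             t * \sum_i grid R n h i ^+ 2) ->
  forall x : 'I_n -> R, \sum_i x i ^+ 2 = 1 ->
  `|pair_sum (fun i j => x i * x j * F i j)| <= 5 * t.
Proof.
move=> n0 t0 Fgrid x x1.
have N0 : 0 < (n ^ 2)%:R :> R by rewrite ltr0n expn_gt0 n0.
have NN : (n ^ 2)%:R / (n ^ 2)%:R = 1 :> R by rewrite divff // gt_eqF.
have F2 (i j : 'I_n) : (i < j)%N -> `|F i j| <= 2 * t.
  move=> ij.
  (* Index [n ^ 2] encodes the value 0 and [ord_max] the value 1. The vector e_i + e_j has squared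
     norm 2, whence the bound 2 t on an entry. *)
  have k0P : (n ^ 2 < (2 * n ^ 2).+1)%N by lia.
  pose h := [ffun k => if (k == i) || (k == j) then ord_max else Ordinal k0P]
    : {ffun 'I_n -> 'I_(2 * n ^ 2).+1}.
  have hE k : grid R n h k = ((k == i) || (k == j))%:R.
    rewrite /grid ffunE; case: ifP => _ /=; last by rewrite NN subrr.
    by rewrite natrM -mulrA NN mulr1; lra.
  have := Fgrid h; rewrite (pair_sum_indicator (v := grid R n h) F ij); last 3 first.
  - by rewrite hE eqxx.
  - by rewrite hE eqxx orbT.
  - by move=> k ki kj; rewrite hE (negPf ki) (negPf kj).
  suff -> : \sum_k grid R n h k ^+ 2 = 2 by rewrite mulrC.
  rewrite (bigD1 i) //= (bigD1 j) /=; last by rewrite -val_eqE gtn_eqF.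
  rewrite big1 ?addr0 ?hE ?eqxx ?orbT /= ?expr1n ?mulr1n; first by lra.
  by move=> k /andP[ki kj]; rewrite hE (negPf ki) (negPf kj) expr0n.
have x_le1 i : `|x i| <= 1.
  rewrite -(@ler_pXn2r _ 2) ?nnegrE // expr1n real_normK ?num_real // -x1.
  by rewrite (bigD1 i) //= lerDl sumr_ge0 // => j _; rewrite sqr_ge0.
pose h := [ffun i => projT1 (cid (grid_approx n0 (x_le1 i)))].
have hP i : `|grid R n h i| <= `|x i| /\ `|x i - grid R n h i| <= (n ^ 2)%:R^-1.
  by rewrite /grid ffunE; case: cid.
have v_le : `|pair_sum (fun i j => grid R n h i * grid R n h j * F i j)| <= t.
  apply: le_trans (Fgrid h) _; rewrite -[leRHS]mulr1 ler_wpM2l // -x1.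
  apply: ler_sum => i _; rewrite -[leLHS]real_normK ?num_real //.
  by rewrite -[leRHS]real_normK ?num_real // lerXn2r ?nnegrE // (hP i).1.
have diff_le : `|pair_sum (fun i j => x i * x j * F i j) -
    pair_sum (fun i j => grid R n h i * grid R n h j * F i j)| <= 4 * t.
  have -> : pair_sum (fun i j => x i * x j * F i j) -
    pair_sum (fun i j => grid R n h i * grid R n h j * F i j) =
    pair_sum (fun i j => (x i * x j - grid R n h i * grid R n h j) * F i j).
    rewrite /pair_sum -sumrB; apply: eq_bigr => i _; rewrite -sumrB.
    by apply: eq_bigr => j _; rewrite -mulrBl.
  (* At most n^2 pairs, each with an error 2 / n^2 in the product of coordinates and an entry of
     size at most 2 t. *)
  have <- : n%:R ^+ 2 * (2 * (n ^ 2)%:R^-1 * (2 * t)) = 4 * t.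
    rewrite -natrX (_ : _ * _ = (n ^ 2)%:R / (n ^ 2)%:R * (4 * t)); last by ring.
    by rewrite NN mul1r.
  apply: ler_norm_pair_sum => [|i j ij].
    by rewrite !mulr_ge0 ?invr_ge0 ?ler0n.
  rewrite normrM ler_pM // ?F2 //.
  have -> : x i * x j - grid R n h i * grid R n h j =
    x i * (x j - grid R n h j) + grid R n h j * (x i - grid R n h i) by ring.
  apply: le_trans (ler_normD _ _) _; rewrite !normrM mulrDl !mul1r lerD //.
    by rewrite -[leRHS]mul1r ler_pM ?x_le1 // (hP j).2.
  by rewrite -[leRHS]mul1r ler_pM ?(le_trans (hP j).1) // (hP i).2.
set X := pair_sum _ in diff_le *; set Y := pair_sum _ in diff_le v_le.
rewrite -(subrK Y X); apply: le_trans (ler_normD _ _) _; lra.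
Qed.

Lemma grid_bound (R : realType) (n : nat) (F : 'I_n -> 'I_n -> R) (t : R) :
  (0 < n)%N -> 0 <= t ->
  (forall h, `|pair_sum (fun i j => grid R n h i * grid R n h j * F i j)| <=
             t * \sum_i grid R n h i ^+ 2) ->
  forall x : 'I_n -> R,
  `|pair_sum (fun i j => x i * x j * F i j)| <= 5 * t * \sum_i x i ^+ 2.
Proof.
move=> n0 t0 Fgrid x; set S := \sum_i x i ^+ 2.
have S_ge0 : 0 <= S by apply: sumr_ge0 => i _; rewrite sqr_ge0.
have [S0|SN] := eqVneq S 0.
  have x0 i : x i = 0.
    apply/eqP; rewrite -sqrf_eq0; apply/eqP.
    by move: i (erefl true); apply: psumr_eq0P S0 => i _; rewrite sqr_ge0.
  rewrite S0 mulr0 /pair_sum big1 ?normr0 // => i _.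
  by rewrite big1 // => j _; rewrite x0 !mul0r.
have S_gt0 : 0 < S by rewrite lt_def SN.
pose c := (Num.sqrt S)^-1.
have cc : c ^+ 2 * S = 1 by rewrite exprVn sqr_sqrtr // mulVf.
have := @grid_bound_unit R n F t n0 t0 Fgrid (fun i => c * x i).
have -> : \sum_i (c * x i) ^+ 2 = 1.
  by rewrite -cc /S mulr_sumr; apply: eq_bigr => i _; rewrite exprMn.
have -> : pair_sum (fun i j => c * x i * (c * x j) * F i j) =
    c ^+ 2 * pair_sum (fun i j => x i * x j * F i j).
  rewrite /pair_sum mulr_sumr; apply: eq_bigr => i _; rewrite mulr_sumr.
  by apply: eq_bigr => j _; ring.
move=> /(_ erefl); rewrite normrM ger0_norm ?sqr_ge0 // => h.
have : S * (c ^+ 2 * `|pair_sum (fun i j => x i * x j * F i j)|) <= S * (5 * t).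
  by rewrite ler_wpM2l.
by rewrite [S * (c ^+ 2 * _)]mulrA [S * c ^+ 2]mulrC cc mul1r [S * _]mulrC.
Qed.

(** The subGaussian condition is applied to the coefficients v_i v_j with [v] on the grid. It
    controls one tail only, so the index set also carries a sign. The deviation 3 sqrt (n ln n) on
    the grid becomes 15 sqrt (n ln n) after the factor 5 lost in discretization. *)
Lemma noise_event (R : realType) (d : measure_display) (T : measurableType d)
    (P : probability T R) (n : nat) (E : 'I_n -> 'I_n -> T -> R) :
  (4 <= n)%N -> (forall i j, measurable_fun setT (E i j)) ->
  subgaussian1 P E ->
  with_prob_ge P (1 - (n%:R ^+ 2)^-1)
    [set w | forall x : 'I_n -> R,
       `|pair_sum (fun i j => x i * x j * E i j w)| <=
       15 * Num.sqrt (n%:R * ln n%:R) * \sum_i x i ^+ 2].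
Proof.
move=> n4 mE subg; set t := 3 * Num.sqrt (n%:R * ln n%:R) : R.
have n0 : (0 < n)%N by lia.
have t0 : 0 <= t by rewrite mulr_ge0 // sqrtr_ge0.
pose I : finType := (bool * {ffun 'I_n -> 'I_(2 * n ^ 2).+1})%type.
pose B (a : I) : 'M[R]_n := \matrix_(i, j)
  ((-1) ^+ a.1 * (grid R n a.2 i * grid R n a.2 j)).
pose S a := pair_sum (fun i j => B a i j ^+ 2).
pose V a w := pair_sum (fun i j => B a i j * E i j w).
pose bad (a : I) := [set w | t * Num.sqrt (S a) < V a w].
have mbad a : measurable (bad a).
  have mV : measurable_fun setT (V a).
    apply: measurable_sum => i.
    rewrite (_ : (fun w => _) = (fun w =>
      \sum_(j < n) if (i < j)%N then B a i j * E i j w else 0)); last first.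
      by apply/funext => w; rewrite big_mkcond.
    apply: measurable_sum => j; case: (i < j)%N; last exact: measurable_cst.
    by apply: measurable_realfun.measurable_funM => //; exact: measurable_cst.
  have mI : measurable [set` `]t * Num.sqrt (S a), +oo[].
    exact: measurable_itv.
  have := mV measurableT _ mI.
  rewrite setTI (_ : _ @^-1` _ = bad a) //; apply/seteqP.
  by split=> w; rewrite /= in_itv /= andbT.
have Pbad a : (P (bad a) <= (expR (- t ^+ 2 / 2))%:E)%E by apply: (subg (B a) t t0).
have [mU PU] := probability_bigsetU_le (index_enum I) mbad Pbad.
set U := \big[setU/set0]_(i <- _) _ in mU PU.
exists (~` U); last first.
  rewrite probability_setC // EFinB leeB // (le_trans PU) // lee_fin.
  have -> : size (index_enum I) = (2 * (2 * n ^ 2).+1 ^ n)%N.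
    rewrite -[index_enum I]enumT -cardT card_prod card_bool card_ffun.
    by rewrite !card_ord.
  by rewrite natrM natrX; apply: noise_probability_bound.
split; first exact: measurableC.
move=> w nU x /=.
have good a : V a w <= t * Num.sqrt (S a).
  rewrite leNgt; apply/negP => ba; apply: nU.
  rewrite /U -bigcup_seq; exists a => //=.
  by rewrite mem_index_enum.
rewrite (_ : 15 * _ = 5 * t); last by rewrite /t; ring.
apply: grid_bound => // h.
set W := pair_sum _.
have VE b : V (b, h) w = (-1) ^+ b * W.
  rewrite /V /W /pair_sum mulr_sumr; apply: eq_bigr => i _.
  rewrite mulr_sumr; apply: eq_bigr => j _; by rewrite mxE /= !mulrA.
have SE b : t * Num.sqrt (S (b, h)) <= t * \sum_i grid R n h i ^+ 2.
  rewrite ler_wpM2l //.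
  have h0 : 0 <= \sum_i grid R n h i ^+ 2 by apply: sumr_ge0 => i _; rewrite sqr_ge0.
  rewrite -[leRHS]ger0_norm // -sqrtr_sqr ler_wsqrtr //.
  apply: le_trans (pair_sum_sqr_le _); rewrite le_eqVlt; apply/orP; left; apply/eqP.
  rewrite /S /pair_sum; apply: eq_bigr => i _; apply: eq_bigr => j _.
  by rewrite mxE /= exprMn sqrr_sign mul1r.
have := le_trans (good (false, h)) (SE false); rewrite VE mul1r => h1.
have := le_trans (good (true, h)) (SE true); rewrite VE expr1 mulN1r => h2.
by rewrite ler_norml h1 andbT lerNl.
Qed.

(** * Eigenvalues and eigenvectors near a diagonalized matrix *)

Lemma spectrum_ortho_diag (R : realType) (n : nat) (M : 'M[R]_n) (s : seq R) :
  M^T = M -> spectrum M s ->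
  size s = n /\ exists2 Q : 'M[R]_n, Q *m Q^T = 1%:M &
    M = Q^T *m diag_mx (\row_i s`_i) *m Q.
Proof.
move=> Msym [_ Mchar]; split; last exact: symmetric_ortho_diag.
have := size_char_poly M; rewrite Mchar size_prod_XsubC => -[].
by [].
Qed.

Section NearDiagonal.
Variables (R : realType) (n : nat) (M N H : 'M[R]_n) (phi : 'rV[R]_n).
Variables (s : seq R) (eta : R) (i0 i1 i2 : 'I_n).
Hypothesis n4 : (4 <= n)%N.
Hypothesis HH : H *m H^T = 1%:M.
Hypothesis NE : N = H^T *m diag_mx phi *m H.
Hypothesis Msym : M^T = M.
Hypothesis Ms : spectrum M s.
Hypothesis MN : forall x, `|qform (M - N) x| <= eta * sqnorm x.
Hypothesis i01 : i0 != i1.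
Hypothesis i02 : i0 != i2.
Hypothesis i12 : i1 != i2.
Hypothesis phi_max : forall j, phi 0 j <= phi 0 i0.
Hypothesis phi_eq : phi 0 i2 = phi 0 i1.
Hypothesis phi_snd : forall j, j != i0 -> phi 0 j <= phi 0 i1 + eta.

Lemma eigenvalue_le (k : nat) (t : R) (J : {set 'I_n}) : (k < 4)%N ->
  (#|J| <= k)%N -> (forall j, j \notin J -> phi 0 j <= t) -> s`_k <= t + eta.
Proof.
move=> k4; have [sn [Q QQ ME]] := spectrum_ortho_diag Msym Ms.
apply: (diag_eigenvalue_le HH NE QQ ME Ms.1 sn MN).
exact: leq_trans k4 n4.
Qed.

Lemma eigenvalue_ge (k : nat) (t : R) (J : {set 'I_n}) : (k < 4)%N ->
  (k < #|J|)%N -> (forall j, j \in J -> t <= phi 0 j) -> t - eta <= s`_k.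
Proof.
move=> k4; have [sn [Q QQ ME]] := spectrum_ortho_diag Msym Ms.
apply: (diag_eigenvalue_ge HH NE QQ ME Ms.1 sn MN).
exact: leq_trans k4 n4.
Qed.

Lemma eigenvalue_decr (k : nat) : (k < 3)%N -> s`_k.+1 <= s`_k.
Proof.
move=> k3; have [sn _] := spectrum_ortho_diag Msym Ms.
by apply: (sorted_ge_nth Ms.1); rewrite sn leqnSn (leq_trans _ n4).
Qed.

Lemma card_main_indices : #|[set i0; i1; i2]%SET| = 3.
Proof. by rewrite -finset.setUA !cardsU1 !inE cards1 negb_or i01 i02 i12. Qed.

Lemma eigenvalue0_le : s`_0 <= phi 0 i0 + eta.
Proof. by apply: (@eigenvalue_le 0 _ finset.set0) => //; rewrite cards0. Qed.

Lemma eigenvalue0_ge : phi 0 i0 - eta <= s`_0.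
Proof.
apply: (@eigenvalue_ge 0 _ [set i0]%SET) => //; first by rewrite cards1.
by move=> j; rewrite inE => /eqP ->.
Qed.

Lemma eigenvalue1_le : s`_1 <= phi 0 i1 + eta + eta.
Proof.
apply: (@eigenvalue_le 1 _ [set i0]%SET) => //; first by rewrite cards1.
by move=> j; rewrite inE => /phi_snd.
Qed.

Lemma eigenvalue2_ge : phi 0 i1 - eta <= s`_2.
Proof.
apply: (@eigenvalue_ge 2 _ [set i0; i1; i2]%SET) => //.
  by rewrite card_main_indices.
by move=> j; rewrite !inE -orbA => /or3P[] /eqP ->; rewrite ?phi_eq.
Qed.

Lemma eigenvalue3_le (t : R) :
  (forall j, j \notin [set i0; i1; i2]%SET -> phi 0 j <= t) -> s`_3 <= t + eta.
Proof.
by apply: (@eigenvalue_le 3 _ [set i0; i1; i2]%SET) => //; rewrite card_main_indices.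
Qed.

(** [phi 0 j] may exceed [phi 0 i1] by [eta], so the four chosen values are only bounded below by
    [phi 0 j - eta]; the second [eta] is the perturbation. *)
Lemma eigenvalue3_ge (j : 'I_n) : 0 <= eta ->
  j \notin [set i0; i1; i2]%SET -> phi 0 j - eta - eta <= s`_3.
Proof.
move=> eta0 jN; apply: (@eigenvalue_ge 3 _ (j |: [set i0; i1; i2])%SET) => //.
  by rewrite cardsU1 jN card_main_indices.
have jle : phi 0 j - eta <= phi 0 i1.
  rewrite lerBlDr phi_snd //; apply: contra jN => /eqP ->.
  by rewrite !inE eqxx.
move=> k; rewrite in_setU1 !inE -orbA => /or4P[] /eqP ->; rewrite ?phi_eq //.
  by rewrite lerBlDr lerDl.
by rewrite (le_trans jle) // phi_max.
Qed.

(* The eigenvector equation for [M] makes [u] an almost eigenvector of [N],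
   whose coordinates in the eigenbasis of [N] are controlled directly. *)
Lemma eigenvector_tail (u : 'rV[R]_n) (sigma gamma : R) :
  0 < eta -> N^T = N -> 0 < gamma ->
  u *m M = sigma *: u -> sqnorm u = 1 ->
  (forall j, j != i1 -> j != i2 -> gamma <= `|phi 0 j - sigma|) ->
  \sum_(j | (j != i1) && (j != i2)) (u *m H^T) 0 j ^+ 2 <= (eta / gamma) ^+ 2.
Proof.
move=> eta0 Nsym gamma0 uM u1 gap.
have sq : sqnorm (u *m (M - N)) <= eta ^+ 2.
  rewrite -[leRHS]mulr1 -u1; apply: sqnorm_mulmx_le => //.
  by rewrite linearB /= Msym Nsym.
have E : sqnorm (u *m (M - N)) =
    \sum_j (phi 0 j - sigma) ^+ 2 * (u *m H^T) 0 j ^+ 2.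
  rewrite -(sqnorm_ortho _ HH) /sqnorm; apply: eq_bigr => j _.
  have -> : u *m (M - N) *m H^T = sigma *: (u *m H^T) - u *m H^T *m diag_mx phi.
    rewrite mulmxBr uM mulmxBl -scalemxAl NE !mulmxA; congr (_ - _).
    by rewrite -[_ *m H *m H^T]mulmxA HH mulmx1.
  rewrite mul_mx_diag !mxE; ring.
rewrite expr_div_n ler_pdivlMr ?exprn_gt0 //; apply: le_trans sq.
rewrite E mulr_suml big_mkcond; apply: ler_sum => j _.
case: ifP => [/andP[j1 j2]|_]; last by rewrite mulr_ge0 ?sqr_ge0.
rewrite mulrC ler_wpM2r ?sqr_ge0 //.
by rewrite -[leRHS]real_normK ?num_real // lerXn2r ?nnegrE ?(ltW gamma0) ?gap.
Qed.
End NearDiagonal.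

(* The first row of the orthogonal matrix is [(a, b)] normalized, the second is
   the perpendicular direction closest to [(c, d)]. *)
Lemma plane_frame_alignment (R : realType) (a b c d e : R) :
  0 <= e -> e <= 4^-1 -> a ^+ 2 + b ^+ 2 <= 1 -> c ^+ 2 + d ^+ 2 <= 1 ->
  1 - e <= a ^+ 2 + b ^+ 2 -> 1 - e <= c ^+ 2 + d ^+ 2 ->
  `|a * c + b * d| <= e ->
  exists p : R * R, exists sg : R,
    [/\ p.1 ^+ 2 + p.2 ^+ 2 = 1, sg ^+ 2 = 1 &
     2 - 3 * e <= p.1 * a + p.2 * b + (- sg * p.2 * c + sg * p.1 * d)].
Proof.
move=> e0 e4 ab1 cd1 ab cd abcd.
pose m := Num.sqrt (a ^+ 2 + b ^+ 2); pose D := a * d - b * c.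
have ab0 : 0 < a ^+ 2 + b ^+ 2 by lra.
have m0 : 0 < m by rewrite sqrtr_gt0.
have mm : m ^+ 2 = a ^+ 2 + b ^+ 2 by rewrite sqr_sqrtr // ltW.
have m1 : m <= 1 by rewrite -(@ler_pXn2r _ 2) ?nnegrE ?(ltW m0) // expr1n mm.
(* Lagrange's identity: near-orthogonality forces the determinant [D] to be close to 1 or -1, and
   its sign decides between rotation and reflection. *)
have DD : D ^+ 2 + (a * c + b * d) ^+ 2 = (a ^+ 2 + b ^+ 2) * (c ^+ 2 + d ^+ 2).
  by rewrite /D; ring.
have abcd2 : (a * c + b * d) ^+ 2 <= e ^+ 2.
  by rewrite -[leLHS]real_normK ?num_real // lerXn2r ?nnegrE.
have D2 : 1 - 2 * e <= D ^+ 2.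
  have : (1 - e) * (1 - e) <= (a ^+ 2 + b ^+ 2) * (c ^+ 2 + d ^+ 2).
    by apply: ler_pM => //; lra.
  by rewrite -DD; lra.
have Dle1 : D ^+ 2 <= 1.
  have : (a ^+ 2 + b ^+ 2) * (c ^+ 2 + d ^+ 2) <= 1 * 1.
    by apply: ler_pM => //; rewrite addr_ge0 ?sqr_ge0.
  by rewrite -DD; have := sqr_ge0 (a * c + b * d); lra.
have Dn : D ^+ 2 <= `|D|.
  have n1 : `|D| <= 1.
    by rewrite -(@ler_pXn2r _ 2) ?nnegrE // expr1n real_normK ?num_real.
  by rewrite -real_normK ?num_real // expr2 ler_piMr.
exists (a / m, b / m), (if 0 <= D then 1 else -1); split=> /=.
- by rewrite !expr_div_n -mulrDl mm divff // gt_eqF.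
- by case: ifP; rewrite ?sqrrN expr1n.
have -> : a / m * a + b / m * b = m.
  have -> : a / m * a + b / m * b = (a ^+ 2 + b ^+ 2) / m by ring.
  by rewrite -mm expr2 mulfK ?gt_eqF.
have -> : forall sg, - sg * (b / m) * c + sg * (a / m) * d = sg * D / m.
  by move=> sg; rewrite /D; ring.
have -> : (if 0 <= D then 1 else -1) * D = `|D|.
  have [D0|D0] := leP 0 D; first by rewrite mul1r ger0_norm.
  by rewrite mulN1r ltr0_norm.
(* Below 1 a number dominates its square, so m + |D| / m is at least m^2 + D^2 >= (1 - e) + (1 - 2
   e). *)
have h1 : m ^+ 2 <= m by rewrite expr2 ler_piMr // ltW.
have h2 : `|D| <= `|D| / m by rewrite ler_pdivlMr // ler_piMr.
lra.
Qed.

Lemma sum_split2 (R : realType) (n : nat) (i1 i2 : 'I_n) (F : 'I_n -> R) :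
  i1 != i2 ->
  \sum_j F j = F i1 + F i2 + \sum_(j | (j != i1) && (j != i2)) F j.
Proof.
move=> i12; rewrite (bigD1 i1) //= (bigD1 i2) /=; last by rewrite eq_sym.
by rewrite addrA.
Qed.

(** Off-plane tails of mass at most [e] change the norms and the inner product of the planar parts
    by at most [e], so the planar alignment applies. As [u], [v] and their targets are unit vectors,
    the squared distances add up to 4 minus twice an inner product of at least 2 - 3 e. *)
Lemma frame_alignment (R : realType) (n : nat) (H : 'M[R]_n) (i1 i2 : 'I_n)
    (u v : 'rV[R]_n) (e : R) :
  H *m H^T = 1%:M -> i1 != i2 -> 0 <= e -> e <= 4^-1 ->
  sqnorm u = 1 -> sqnorm v = 1 -> (u *m v^T) 0 0 = 0 ->
  \sum_(j | (j != i1) && (j != i2)) (u *m H^T) 0 j ^+ 2 <= e ->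
  \sum_(j | (j != i1) && (j != i2)) (v *m H^T) 0 j ^+ 2 <= e ->
  exists p : R * R, exists sg : R,
    [/\ p.1 ^+ 2 + p.2 ^+ 2 = 1, sg ^+ 2 = 1 &
     sqnorm (u - (p.1 *: row i1 H + p.2 *: row i2 H)) +
     sqnorm (v - ((- sg * p.2) *: row i1 H + (sg * p.1) *: row i2 H)) <= 6 * e].
Proof.
move=> HH i12 e0 e4 u1 v1 uv tu tv.
have dist (w : 'rV[R]_n) (a b : R) : sqnorm (w - (a *: row i1 H + b *: row i2 H)) =
    ((w *m H^T) 0 i1 - a) ^+ 2 + ((w *m H^T) 0 i2 - b) ^+ 2 +
    \sum_(j | (j != i1) && (j != i2)) (w *m H^T) 0 j ^+ 2.
  rewrite -(sqnorm_ortho _ HH) /sqnorm.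
  have rowH k : row k H *m H^T = delta_mx 0 k by rewrite -row_mul HH row1.
  rewrite mulmxBl mulmxDl -!scalemxAl !rowH.
  set z := w *m H^T; rewrite (sum_split2 _ i12); congr (_ + _ + _).
  - by rewrite !mxE !eqxx (negPf i12) !mulr1 mulr0 addr0.
  - by rewrite !mxE !eqxx eq_sym (negPf i12) !mulr1 mulr0 add0r.
  apply: eq_bigr => j /andP[j1 j2].
  by rewrite !mxE eqxx (negPf j1) (negPf j2) !mulr0 addr0 subr0.
have norm_split (w : 'rV[R]_n) : sqnorm w =
    (w *m H^T) 0 i1 ^+ 2 + (w *m H^T) 0 i2 ^+ 2 +
    \sum_(j | (j != i1) && (j != i2)) (w *m H^T) 0 j ^+ 2.
  by rewrite -(sqnorm_ortho _ HH) /sqnorm (sum_split2 _ i12).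
have nu := norm_split u; have nv := norm_split v; rewrite u1 in nu; rewrite v1 in nv.
have dot : (u *m H^T) 0 i1 * (v *m H^T) 0 i1 + (u *m H^T) 0 i2 * (v *m H^T) 0 i2 +
    \sum_(j | (j != i1) && (j != i2)) (u *m H^T) 0 j * (v *m H^T) 0 j = 0.
  rewrite -(@sum_split2 _ _ _ _ (fun j => (u *m H^T) 0 j * (v *m H^T) 0 j)) //.
  rewrite -[RHS]uv; have HTH : H^T *m H = 1%:M by apply: mulmx1C.
  have -> : u *m v^T = (u *m H^T) *m (v *m H^T)^T.
    by rewrite trmx_mul trmxK mulmxA -[u *m H^T *m H]mulmxA HTH mulmx1.
  by rewrite [RHS]mxE; apply: eq_bigr => j _; rewrite [(_ *m _)^T _ _]mxE.
have tail : `|\sum_(j | (j != i1) && (j != i2)) (u *m H^T) 0 j * (v *m H^T) 0 j| <= e.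
  apply: le_trans (ler_norm_sum _ _ _) _.
  apply: (@le_trans _ _ (2^-1 * (e + e))); last by lra.
  apply: le_trans (ler_wpM2l _ (lerD tu tv)); last by rewrite invr_ge0.
  rewrite -big_split mulr_sumr; apply: ler_sum => j _ /=.
  rewrite normrM -[X in X + _]real_normK ?num_real // -[X in _ + X]real_normK ?num_real //.
  by have := sqr_ge0 (`|(u *m H^T) 0 j| - `|(v *m H^T) 0 j|); lra.
move: nu nv dot tail tu tv dist.
set tu := \sum_(j | _) (u *m H^T) 0 j ^+ 2; set tv := \sum_(j | _) (v *m H^T) 0 j ^+ 2.
set tt := \sum_(j | _) _ * _.
set a := (u *m H^T) 0 i1; set b := (u *m H^T) 0 i2.
set c := (v *m H^T) 0 i1; set d := (v *m H^T) 0 i2.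
move=> nu nv dot tail htu htv dist.
have tu0 : 0 <= tu by apply: sumr_ge0 => j _; rewrite sqr_ge0.
have tv0 : 0 <= tv by apply: sumr_ge0 => j _; rewrite sqr_ge0.
have [|||||p [sg [p1 sg1 tr]]] := @plane_frame_alignment R a b c d e e0 e4.
- by lra.
- by lra.
- by lra.
- by lra.
- by rewrite (_ : _ + _ = - tt) ?normrN //; lra.
exists p, sg; split=> //; rewrite !dist -/a -/b -/c -/d -/tu -/tv.
have e2 : (- sg * p.2) ^+ 2 + (sg * p.1) ^+ 2 = 1.
  by rewrite !exprMn sqrrN sg1 !mul1r addrC.
have -> : (a - p.1) ^+ 2 + (b - p.2) ^+ 2 + tu = (a ^+ 2 + b ^+ 2 + tu) -
  2 * (p.1 * a + p.2 * b) + (p.1 ^+ 2 + p.2 ^+ 2) by ring.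
have -> : (c - - sg * p.2) ^+ 2 + (d - sg * p.1) ^+ 2 + tv = (c ^+ 2 + d ^+ 2 + tv) -
  2 * (- sg * p.2 * c + sg * p.1 * d) + ((- sg * p.2) ^+ 2 + (sg * p.1) ^+ 2) by ring.
by rewrite -nu -nv p1 e2; lra.
Qed.

(** * The entrywise norm and the loss up to orthogonal matrices *)

Lemma mxnorm1D (R : realType) (m n : nat) (M N : 'M[R]_(m, n)) :
  mxnorm1 (M + N) <= mxnorm1 M + mxnorm1 N.
Proof.
rewrite /mxnorm1 -big_split; apply: ler_sum => i _ /=.
by rewrite -big_split; apply: ler_sum => j _ /=; rewrite mxE ler_normD.
Qed.

Lemma mxnorm1N (R : realType) (m n : nat) (M : 'M[R]_(m, n)) :
  mxnorm1 (- M) = mxnorm1 M.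
Proof.
by apply: eq_bigr => i _; apply: eq_bigr => j _; rewrite mxE normrN.
Qed.

Lemma mxnorm1_ge0 (R : realType) (m n : nat) (M : 'M[R]_(m, n)) : 0 <= mxnorm1 M.
Proof. by apply: sumr_ge0 => i _; apply: sumr_ge0. Qed.

(** Arithmetic-geometric mean inequality on each entry, in place of Cauchy-Schwarz; [tau] is meant
    to be the typical size of an entry. *)
Lemma mxnorm1_le_sqr (R : realType) (n : nat) (M : 'M[R]_(2, n)) (tau : R) :
  0 < tau ->
  mxnorm1 M <= ((sqnorm (row 0 M) + sqnorm (row 1 M)) / tau + 2 * n%:R * tau) / 2.
Proof.
move=> tau0; rewrite /mxnorm1 big_ord_recl big_ord1.
have half k : \sum_(j < n) `|M k j| <= (sqnorm (row k M) / tau + n%:R * tau) / 2.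
  have -> : n%:R * tau = \sum_(j < n) tau by rewrite sumr_const card_ord mulr_natl.
  rewrite /sqnorm !mulr_suml -big_split mulr_suml; apply: ler_sum => j _ /=.
  rewrite mxE ler_pdivlMr // -(ler_pM2r tau0) mulrDl divfK ?gt_eqF //.
  rewrite -[M k j ^+ 2]real_normK ?num_real //.
  by have := sqr_ge0 (`|M k j| - tau); lra.
have := half 0; have := half (lift ord0 ord0).
rewrite (_ : lift ord0 ord0 = 1); last exact: val_inj.
lra.
Qed.

Lemma ortho_loss_le (R : realType) (n : nat) (X Y : 'M[R]_(2, n)) (Q : 'M[R]_2) :
  Q^T *m Q = 1%:M -> ortho_loss X Y <= mxnorm1 (X - Q *m Y).
Proof.
move=> QQ; apply: ge_inf; last by exists Q.
by exists 0 => z [Q' _ <-]; apply: mxnorm1_ge0.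
Qed.

Lemma ord2_cases (i : 'I_2) : i = 0 \/ i = 1.
Proof. by case: i => -[|[|i]] hi; [left|right|]; try exact: val_inj. Qed.

Definition frame_mx (R : realType) (n : nat) (u v : 'rV[R]_n) : 'M[R]_(2, n) :=
  Num.sqrt (n%:R / 2) *: \matrix_(a < 2, i < n) (if a == 0 then u 0 i else v 0 i).

Lemma circle_val_le1 (R : realType) (x : circle R) :
  `|(val x).1| <= 1 /\ `|(val x).2| <= 1.
Proof.
case: x => -[a b] /= /eqP ab.
by split; rewrite -(@ler_pXn2r _ 2) ?nnegrE // expr1n real_normK ?num_real // -ab;
  rewrite ?lerDl ?lerDr sqr_ge0.
Qed.

Lemma row_frame_mx (R : realType) (n : nat) (u v : 'rV[R]_n) :
  row 0 (frame_mx u v) = Num.sqrt (n%:R / 2) *: u /\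
  row 1 (frame_mx u v) = Num.sqrt (n%:R / 2) *: v.
Proof. by split; apply/rowP => j; rewrite !mxE. Qed.

Lemma sqnormZ (R : realType) (n : nat) (a : R) (u : 'rV[R]_n) :
  sqnorm (a *: u) = a ^+ 2 * sqnorm u.
Proof. by rewrite /sqnorm mulr_sumr; apply: eq_bigr => i _; rewrite mxE exprMn. Qed.

Lemma ortho_loss_trivial (R : realType) (n : nat) (x : 'I_n -> circle R)
    (u v : 'rV[R]_n) :
  sqnorm u = 1 -> sqnorm v = 1 ->
  ortho_loss (frame_mx u v) (circle_mx x) <= 4 * n%:R.
Proof.
move=> u1 v1; have := @ortho_loss_le R n (frame_mx u v) (circle_mx x) 1%:M.
rewrite trmx1 mulmx1 mul1mx => /(_ erefl) h; apply: le_trans h _.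
apply: le_trans (mxnorm1D _ _) _; rewrite mxnorm1N.
have hX : mxnorm1 (frame_mx u v) <= 3 / 2 * n%:R.
  apply: le_trans (mxnorm1_le_sqr _ ltr01) _.
  rewrite (row_frame_mx u v).1 (row_frame_mx u v).2 !sqnormZ u1 v1 sqr_sqrtr; first by lra.
  by rewrite divr_ge0 ?ler0n.
have hY : mxnorm1 (circle_mx x) <= 2 * n%:R.
  have -> : 2 * n%:R = \sum_(i < 2) \sum_(j < n) 1 :> R.
    by rewrite !sumr_const !card_ord mulr_natl.
  apply: ler_sum => i _; apply: ler_sum => j _; rewrite mxE.
  by case: ifP => _; rewrite ?(circle_val_le1 _).1 ?(circle_val_le1 _).2.
by have := ler0n R n; lra.
Qed.

Lemma ortho_mx2_entry (R : realType) (Q : 'M[R]_2) (i j : 'I_2) :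
  Q^T *m Q = 1%:M -> `|Q i j| <= 1.
Proof.
move=> /matrixP/(_ j j); rewrite !mxE eqxx (bigD1 i) //= mxE -expr2 => h.
rewrite -(@ler_pXn2r _ 2) ?nnegrE // expr1n real_normK ?num_real //.
rewrite -[leRHS]/(1%:R) -h lerDl sumr_ge0 // => k _.
by rewrite mxE -expr2 sqr_ge0.
Qed.

Lemma mxnorm1_ortho_circle (R : realType) (n : nat) (Q : 'M[R]_2)
    (x y : 'I_n -> circle R) (beta : R) : Q^T *m Q = 1%:M ->
  (forall i, cdist (x i) (y i) <= beta) ->
  mxnorm1 (Q *m (circle_mx y - circle_mx x)) <= 4 * n%:R * beta.
Proof.
move=> QQ xy; have -> : 4 * n%:R * beta = \sum_(i < 2) \sum_(j < n) (2 * beta).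
  by rewrite !sumr_const !card_ord -[in RHS]mulr_natl -[_ *+ n]mulr_natl; ring.
apply: ler_sum => i _; apply: ler_sum => j _.
rewrite mxE big_ord_recl big_ord1 !mxE /=.
have [h1 h2] := circle_coord_lipschitz (x j) (y j).
apply: le_trans (ler_normD _ _) _; rewrite (_ : 2 * beta = beta + beta); last by ring.
rewrite !normrM; apply: lerD; rewrite -[leRHS]mul1r ler_pM ?ortho_mx2_entry //.
  by rewrite distrC (le_trans h1).
by rewrite distrC (le_trans h2).
Qed.

Lemma hartley_row (R : realType) (n : nat) (p : 'I_n -> nat) (i1 i2 j : 'I_n) :
  (0 < n)%N -> i1 = 1%N :> nat -> i2 = n.-1 :> nat ->
  hartley_mx R p i1 j =
    (cos (root_angle R n (p j)) + sin (root_angle R n (p j))) / Num.sqrt n%:R /\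
  hartley_mx R p i2 j =
    (cos (root_angle R n (p j)) - sin (root_angle R n (p j))) / Num.sqrt n%:R.
Proof.
move=> n0 i1E i2E; rewrite !mxE i1E i2E mul1n /cas; split=> //.
have [c s] := root_angleBn n0 (p j) (0 : R) n0.
rewrite mulnC -subn1 -[root_angle R n (p j * (n - 1))]add0r c s muln1.
by rewrite sub0r cosN sinN.
Qed.

Lemma ortho_loss_frame (R : realType) (n : nat) (p : 'I_n -> nat)
    (x y : 'I_n -> circle R) (i1 i2 : 'I_n) (u v : 'rV[R]_n) (rho beta : R) :
  (4 <= n)%N -> (forall k, (0 < p k <= n)%N) -> injective p ->
  (forall k, y k = cexp (root_angle R n (p k))) ->
  (forall k, cdist (x k) (y k) <= beta) ->
  i1 = 1%N :> nat -> i2 = n.-1 :> nat -> 0 < rho -> rho <= 2^-1 ->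
  sqnorm u = 1 -> sqnorm v = 1 -> (u *m v^T) 0 0 = 0 ->
  \sum_(j | (j != i1) && (j != i2)) (u *m (hartley_mx R p)^T) 0 j ^+ 2 <= rho ^+ 2 ->
  \sum_(j | (j != i1) && (j != i2)) (v *m (hartley_mx R p)^T) 0 j ^+ 2 <= rho ^+ 2 ->
  ortho_loss (frame_mx u v) (circle_mx x) <= 5 / 2 * n%:R * rho + 4 * n%:R * beta.
Proof.
move=> n4 pn pI yp xy i1E i2E rho0 rho2 u1 v1 uv tu tv.
have n0 : (0 < n)%N by lia.
have nR : 0 < n%:R :> R by rewrite ltr0n.
have HH := hartley_ortho R n0 pn pI.
have i12 : i1 != i2 by rewrite -val_eqE /= i1E i2E; lia.
have e0 : 0 <= rho ^+ 2 by rewrite sqr_ge0.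
have e4 : rho ^+ 2 <= 4^-1.
  have -> : 4^-1 = 2^-1 ^+ 2 :> R by field.
  by rewrite lerXn2r ?nnegrE ?(ltW rho0).
have [p' [sg [p1 sg1 dist]]] := frame_alignment HH i12 e0 e4 u1 v1 uv tu tv.
pose s2 : R := Num.sqrt 2.
have s20 : s2 != 0 by rewrite gt_eqF // sqrtr_gt0.
have s22 : s2 ^+ 2 = 2 by rewrite sqr_sqrtr.
(* Up to scaling, the Hartley rows of index 1 and n - 1 are cos + sin and cos - sin. Rewriting the
   aligned combinations in terms of cos and sin gives the entries of [Q], and [s2] restores the
   normalization. *)
pose a := (p'.1 + p'.2) / s2; pose b := (p'.1 - p'.2) / s2.
have ab : a ^+ 2 + b ^+ 2 = 1.
  rewrite /a /b !expr_div_n s22 -[RHS]p1; by field.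
pose Q : 'M[R]_2 := \matrix_(i, j)
  if i == 0 then (if j == 0 then a else b) else (if j == 0 then sg * b else - sg * a).
have QQ : Q^T *m Q = 1%:M.
  apply/matrixP => i j; rewrite mxE big_ord_recl big_ord1 !mxE /=.
  have e1 : a * b + sg * b * (- sg * a) = 0.
    have -> : a * b + sg * b * (- sg * a) = a * b * (1 - sg ^+ 2) by ring.
    by rewrite sg1 subrr mulr0.
  have e2 : b * a + - sg * a * (sg * b) = 0 by rewrite -[RHS]e1; ring.
  have e3 : a * a + sg * b * (sg * b) = 1.
    have -> : a * a + sg * b * (sg * b) = a ^+ 2 + sg ^+ 2 * b ^+ 2 by ring.
    by rewrite sg1 mul1r ab.
  have e5 : b * b + - sg * a * (- sg * a) = 1.
    have -> : b * b + - sg * a * (- sg * a) = b ^+ 2 + sg ^+ 2 * a ^+ 2 by ring.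
    by rewrite sg1 mul1r addrC ab.
  by case: (ord2_cases i) => ->; case: (ord2_cases j) => ->; rewrite /= ?e1 ?e2 ?e3 ?e5 //.
apply: le_trans (ortho_loss_le _ _ QQ) _.
have -> : frame_mx u v - Q *m circle_mx x =
    (frame_mx u v - Q *m circle_mx y) + Q *m (circle_mx y - circle_mx x).
  by rewrite mulmxBr addrA subrK.
apply: le_trans (mxnorm1D _ _) _; apply: lerD; last exact: mxnorm1_ortho_circle.
(* With [tau = rho] and squared error at most (n / 2) 6 rho^2, the bound is (3 n rho + 2 n rho) /
   2. *)
apply: le_trans (mxnorm1_le_sqr _ rho0) _.
pose sn : R := Num.sqrt n%:R.
have sn0 : sn != 0 by rewrite gt_eqF // sqrtr_gt0.
have sE : Num.sqrt (n%:R / 2) = sn / s2 by rewrite sqrtrM ?sqrtrV ?ler0n.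
have QyE k j : (Q *m circle_mx y) k j =
    Q k 0 * cos (root_angle R n (p j)) + Q k 1 * sin (root_angle R n (p j)).
  rewrite mxE big_ord_recl big_ord1 (_ : lift ord0 ord0 = 1); last exact: val_inj.
  by rewrite ![circle_mx y _ _]mxE yp.
have rE (k : 'I_2) (w : 'rV[R]_n) (c e : R) :
    row k (frame_mx u v) = Num.sqrt (n%:R / 2) *: w ->
    Q k 0 = (c + e) / s2 -> Q k 1 = (c - e) / s2 ->
    row k (frame_mx u v - Q *m circle_mx y) = Num.sqrt (n%:R / 2) *:
    (w - (c *: row i1 (hartley_mx R p) + e *: row i2 (hartley_mx R p))).
  move=> /rowP rw Q0 Q1; apply/rowP => j.
  have [h1 h2] := hartley_row R p j n0 i1E i2E.
  have := rw j; rewrite mxE [RHS]mxE => rwj.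
  have -> : row k (frame_mx u v - Q *m circle_mx y) 0 j =
      frame_mx u v k j - (Q *m circle_mx y) k j.
    by rewrite mxE [LHS]mxE [X in _ + X]mxE.
  have -> : (Num.sqrt (n%:R / 2) *:
      (w - (c *: row i1 (hartley_mx R p) + e *: row i2 (hartley_mx R p)))) 0 j =
      Num.sqrt (n%:R / 2) * (w 0 j - (c * hartley_mx R p i1 j + e * hartley_mx R p i2 j)).
    rewrite mxE; congr (_ * _); rewrite mxE [X in _ + X]mxE; congr (_ - _).
    rewrite mxE; congr (_ + _); rewrite mxE; congr (_ * _); by rewrite mxE.
  rewrite rwj QyE Q0 Q1 h1 h2 sE -/sn; field.
  by rewrite sn0 s20.
have r0 := @rE 0 u p'.1 p'.2 (row_frame_mx u v).1.
have r1 := @rE 1 v (- sg * p'.2) (sg * p'.1) (row_frame_mx u v).2.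
rewrite r0 ?r1; first last.
- by rewrite mxE.
- by rewrite mxE.
- by rewrite mxE /= /a; ring.
- by rewrite mxE /= /b; ring.
rewrite !sqnormZ -mulrDr sqr_sqrtr ?divr_ge0 ?ler0n //.
have : n%:R / 2 * (sqnorm (u -
    (p'.1 *: row i1 (hartley_mx R p) + p'.2 *: row i2 (hartley_mx R p))) +
   sqnorm (v - ((- sg * p'.2) *: row i1 (hartley_mx R p) +
        (sg * p'.1) *: row i2 (hartley_mx R p)))) <= n%:R / 2 * (6 * rho ^+ 2).
  by rewrite ler_wpM2l // divr_ge0 ?ler0n.
rewrite -[X in _ <= X -> _](_ : 3 * n%:R * rho * rho = _); last by field.
rewrite -ler_pdivrMr // => h; lra.
Qed.

(** * The spectral algorithm *)

Lemma qform_entry_le (R : realType) (n : nat) (M : 'M[R]_n) (c : R) (x : 'rV[R]_n) :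
  (forall i j, `|M i j| <= c) -> `|qform M x| <= n%:R * c * sqnorm x.
Proof.
move=> Mc; have -> : n%:R * c * sqnorm x =
    \sum_i \sum_j c * ((x 0 i ^+ 2 + x 0 j ^+ 2) / 2).
  have -> : \sum_i \sum_j c * ((x 0 i ^+ 2 + x 0 j ^+ 2) / 2) =
      \sum_i (c / 2 * (n%:R * x 0 i ^+ 2 + sqnorm x)).
    apply: eq_bigr => i _; rewrite -mulr_sumr -mulr_suml big_split /=.
    by rewrite sumr_const card_ord -[_ *+ n]mulr_natl /sqnorm; ring.
  rewrite -mulr_sumr big_split /= -mulr_sumr sumr_const card_ord.
  by rewrite -[_ *+ n]mulr_natl -/(sqnorm x); field.
rewrite qformE (le_trans (ler_norm_sum _ _ _)) //; apply: ler_sum => i _.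
rewrite (le_trans (ler_norm_sum _ _ _)) //; apply: ler_sum => j _.
rewrite !normrM [`|x 0 i| * _]mulrC -mulrA ler_pM ?mulr_ge0 ?Mc //.
rewrite -[x 0 i ^+ 2]real_normK ?num_real // -[x 0 j ^+ 2]real_normK ?num_real //.
by have := sqr_ge0 (`|x 0 i| - `|x 0 j|); lra.
Qed.

Lemma sum_symmetric (R : realType) (n : nat) (G : 'I_n -> 'I_n -> R) :
  (forall i j, G i j = G j i) ->
  \sum_i \sum_j G i j = 2 * pair_sum G + \sum_i G i i.
Proof.
move=> Gsym.
have -> : \sum_i \sum_j G i j =
    \sum_(i < n) (\sum_(j < n | (i < j)%N) G i j + \sum_(j < n | (j < i)%N) G i j + G i i).
  apply: eq_bigr => i _; rewrite (bigID (fun j : 'I_n => (i < j)%N)) /= -addrA.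
  congr (_ + _); rewrite (bigD1 i) /=; last by rewrite ltnn.
  rewrite addrC; congr (_ + _); apply: eq_bigl => j.
  by rewrite -leqNgt -val_eqE /= [RHS]ltn_neqAle andbC.
rewrite !big_split /=; congr (_ + _); rewrite mulrDl mul1r; congr (_ + _).
rewrite (exchange_big_dep predT) //=; apply: eq_bigr => i _.
by apply: eq_bigr => j _.
Qed.

Lemma mulr_sqrt_div (R : realType) (n : nat) : (0 < n)%N ->
  n%:R * Num.sqrt (ln n%:R / n%:R) = Num.sqrt (n%:R * ln n%:R) :> R.
Proof.
move=> n0; have nR : 0 < n%:R :> R by rewrite ltr0n.
rewrite -{1}[n%:R]ger0_norm ?ler0n // -sqrtr_sqr -sqrtrM ?sqr_ge0 //.
by congr Num.sqrt; field; rewrite gt_eqF.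
Qed.

Lemma ln_nat_bounds (R : realType) (n : nat) : (4 <= n)%N ->
  [/\ 0 < Num.sqrt (ln n%:R / n%:R) :> R,
      1 <= Num.sqrt (n%:R * ln n%:R) :> R
    & Num.sqrt (n%:R * ln n%:R) <= n%:R :> R].
Proof.
move=> n4; have n4R : 4 <= n%:R :> R by rewrite ler_nat.
have nR : 0 < n%:R :> R by lra.
have lnle : ln n%:R <= n%:R :> R by rewrite ltW // ln_sublinear.
(* The inequality ln (1 + t) <= t at t = 1 / n - 1 gives ln n >= 1 - 1 / n. *)
have lnge : 3 / 4 <= ln n%:R :> R.
  have ninv : n%:R^-1 <= 4^-1 :> R by rewrite lef_pV2 ?posrE.
  have ninv0 : 0 < n%:R^-1 :> R by rewrite invr_gt0.
  have : -1 < n%:R^-1 - 1 :> R by lra.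
  move=> /le_ln1Dx; rewrite addrC subrK lnV ?posrE //; lra.
split.
- by rewrite sqrtr_gt0; apply: divr_gt0 => //; apply: lt_le_trans lnge; lra.
- have h : 4 * (3 / 4) <= n%:R * ln n%:R :> R by apply: ler_pM => //; lra.
  by rewrite -[leLHS]sqrtr1 ler_wsqrtr //; apply: le_trans h; lra.
- by rewrite -[leRHS]ger0_norm ?ler0n // -sqrtr_sqr ler_wsqrtr // expr2 ler_pM2l.
Qed.

(** The infimum is approached to within [c] instead of being attained, whence the factor 2. *)
Lemma nearby_regular_tuple (R : realType) (n : nat) (x : 'I_n -> circle R) (c : R) :
  0 < c -> cdist_regular x <= c ->
  exists s : 'S_n,
    forall i, cdist (x i) (cexp (2 * pi * (s i).+1%:R / n%:R)) <= 2 * c.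
Proof.
move=> c0 xc.
have hinf : has_inf [set cdist_max x y | y in regular_tuples R n].
  split.
    exists (cdist_max x (fun j => cexp (2 * pi * ((1%g : 'S_n) j).+1%:R / n%:R))).
    by exists (fun j => cexp (2 * pi * ((1%g : 'S_n) j).+1%:R / n%:R)) => //; exists 1%g.
  exists 0 => z [y _ <-]; rewrite /cdist_max.
  by apply: bigmax_ge_id.
have [z [y [s ys] <-] hz] := inf_adherent c0 hinf.
exists s => i; rewrite -ys.
have h : cdist (x i) (y i) <= cdist_max x y.
  exact: (le_bigmax _ (fun i => cdist (x i) (y i))).
by apply: (le_trans h); rewrite /cdist_regular in xc; lra.
Qed.

Lemma vanilla_spectral_frame (R : realType) (n : nat) (A : 'M[R]_n)
    (X : 'M[R]_(2, n)) : A^T = A -> vanilla_spectral A X ->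
  exists s u v, [/\ spectrum A s, u *m A = s`_1 *: u /\ v *m A = s`_2 *: v,
    [/\ sqnorm u = 1, sqnorm v = 1 & (u *m v^T) 0 0 = 0] & X = frame_mx u v].
Proof.
move=> Asym [s [u [v [As [Au Av] [uu vv uv] ->]]]]; exists s, u^T, v^T.
split=> //.
- by rewrite -{1}Asym -trmx_mul Au linearZ -{1}Asym -trmx_mul Av linearZ.
- split; rewrite ?trmxK ?uv ?mxE //.
  + by rewrite /sqnorm -row_sqr_sum trmxK uu mxE.
  + by rewrite /sqnorm -row_sqr_sum trmxK vv mxE.
- by rewrite /frame_mx; congr (_ *: _); apply/matrixP => i j; rewrite !mxE.
Qed.

Lemma dft_le_Phi2 (R : realType) (n q j : nat) (g : R -> R) :
  n = (2 * q)%N -> (2 <= q)%N -> (2 <= j <= 2 * q - 2)%N ->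
  dft n g j <= dft n g 1 - Phi2 n g.
Proof.
move=> -> q2; wlog jq : j / (j <= q)%N.
  move=> hw hj; have [|qj] := leqP j q; first by move=> /hw; apply.
  rewrite -dft_sym; try lia.
  by apply: hw; lia.
move=> /andP[j2 _]; rewrite lerBrDr -lerBrDl /Phi2.
apply: (@ge_bigmin_seq _ _ _ _ _ j xpredT
  (fun j => dft (2 * q) g 1 - dft (2 * q) g j)) => //.
by rewrite mem_index_iota j2 ltnS /=; lia.
Qed.

Lemma affinity_perturbation (R : realType) (n : nat) (cl cL ce beta : R)
    (f : circle R -> circle R -> R) (x y : 'I_n -> circle R) (i j : 'I_n) :
  BL cl cL ce n f -> 0 <= cL -> (forall i, cdist (x i) (y i) <= beta) ->
  `|(affinity_mx f x - affinity_mx f y) i j| <= 2 * (cL * beta + BLeps ce n).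
Proof.
move=> [fsym _ flip _] cL0 xy; rewrite !mxE.
rewrite -(subrKA (f (x i) (y j))) (le_trans (ler_normD _ _)) //.
have h k : cL * cdist (x k) (y k) <= cL * beta by rewrite ler_wpM2l.
have h1 := flip (x i) (x j) (y j); have h2 := flip (y j) (x i) (y i).
rewrite !(fsym (y j)) in h2.
by have := h i; have := h j; lra.
Qed.

(** Each pair of symmetric off-diagonal entries counts twice. The zero diagonal of [A] leaves minus
    the diagonal of [F], whose form is at most [sqnorm x]; this is the extra 1. *)
Lemma qform_noise_le (R : realType) (n : nat) (A F : 'M[R]_n) (c : R)
    (x : 'rV[R]_n) :
  A^T = A -> F^T = F -> (forall i, A i i = 0) -> (forall i, 0 <= F i i <= 1) ->
  `|pair_sum (fun i j => x 0 i * x 0 j * (A i j - F i j))| <= c * sqnorm x ->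
  `|qform (A - F) x| <= (2 * c + 1) * sqnorm x.
Proof.
move=> Asym Fsym A0 F01 hc.
have symE (M : 'M[R]_n) i j : M^T = M -> M i j = M j i by move=> e; rewrite -{1}e mxE.
have -> : qform (A - F) x = \sum_i \sum_j x 0 i * x 0 j * (A i j - F i j).
  by rewrite qformE; apply: eq_bigr => i _; apply: eq_bigr => j _; rewrite !mxE; ring.
rewrite sum_symmetric; last first.
  by move=> i j; rewrite (symE _ _ _ Asym) (symE _ i j Fsym); ring.
apply: le_trans (ler_normD _ _) _; rewrite [leRHS]mulrDl mul1r; apply: lerD.
  by rewrite normrM ger0_norm // -mulrA ler_wpM2l.
apply: le_trans (ler_norm_sum _ _ _) _; apply: ler_sum => i _.
rewrite A0 sub0r mulrN normrN -expr2 normrM ger0_norm ?sqr_ge0 //.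
by have /andP[f0 f1] := F01 i; rewrite ger0_norm // ler_piMr // sqr_ge0.
Qed.

(** The deterministic core. In [c1], the term 2 (2 cL ca + ce) is the distance between the affinity
    matrices at [x] and at [y], 31 = 2 * 15 + 1 is the noise with the missing diagonal, and 2 ce is
    the defect of monotonicity. *)
Lemma spectral_loss_bounds (R : realType) (cl cL ce ca : R) (n q : nat)
    (f : circle R -> circle R -> R) (g : R -> R) (x : 'I_n -> circle R)
    (lam : seq R) (A : 'M[R]_n) (X : 'M[R]_(2, n)) :
  let c1 := 2 * (2 * cL * ca + ce) + 31 + 2 * ce in
  let r := Num.sqrt (n%:R * ln n%:R) in
  let delta := Num.min (lam`_0 - lam`_1) (lam`_2 - lam`_3) in
  0 < ca -> 0 <= ce -> 0 < cl -> cl <= cL -> (4 <= n)%N -> n = (2 * q)%N ->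
  BL cl cL ce n f ->
  (forall t : R, 0 <= t <= pi -> 0 <= g t <= 1) ->
  (forall y z, f y z = g (cdist y z)) ->
  cdist_regular x <= ca * Num.sqrt (ln n%:R / n%:R) ->
  spectrum (affinity_mx f x) lam ->
  A^T = A -> (forall i, A i i = 0) ->
  (forall z : 'I_n -> R,
    `|pair_sum (fun i j => z i * z j * (A i j - affinity_mx f x i j))| <=
    15 * r * \sum_i z i ^+ 2) ->
  vanilla_spectral A X ->
  ortho_loss X (circle_mx x) <= 4 * n%:R /\
  (10 * (c1 * r) <= delta -> ortho_loss X (circle_mx x) <=
     (5 * c1 + 8 * ca * (2 + 2 * c1)) * (n%:R * r / delta)) /\
  Num.min (Phi1 n g) (Phi2 n g) - 3 * c1 * r <= delta.
Proof.
move=> c1 r delta ca0 ce0 cl0 clL n4 nE fBL g01 fg xreg Flam Asym A0 noise XA.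
have n0 : (0 < n)%N by lia.
have q2 : (2 <= q)%N by lia.
have q0 : (0 < q)%N by lia.
have lt1n : (1 < n)%N by lia.
have ltn1n : (n.-1 < n)%N by lia.
have n1N0 : 0%N != n.-1 by lia.
have n1N1 : 1%N != n.-1 by lia.
have fold_index j : (j < n)%N -> (q < j)%N -> (0 < n - j <= q)%N by lia.
have off_index j : (j < n)%N -> j != 0%N -> j != 1%N -> j != n.-1 ->
    (2 <= j <= 2 * q - 2)%N by lia.
have [sq0 r1 rn] := ln_nat_bounds R n4.
have scale := mulr_sqrt_div R n0.
rewrite -/r in r1 rn scale; set sq := Num.sqrt (ln n%:R / n%:R) in sq0 scale xreg.
have cL0 : 0 <= cL by lra.
have [s sreg] := nearby_regular_tuple (mulr_gt0 ca0 sq0) xreg.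
set beta := 2 * (ca * sq) in sreg.
pose p (i : 'I_n) := (s i).+1.
pose y (i : 'I_n) : circle R := cexp (root_angle R n (p i)).
have pn k : (0 < p k <= n)%N by rewrite /p /= ltn_ord.
have pI : injective p by move=> i j [] /val_inj /perm_inj.
have yp k : y k = cexp (root_angle R n (p k)) by [].
have xy k : cdist (x k) (y k) <= beta by apply: sreg.
pose F := affinity_mx f x; pose N := affinity_mx f y.
pose H := hartley_mx R p; pose phi : 'rV[R]_n := \row_k dft n g k.
have HH : H *m H^T = 1%:M := hartley_ortho R n0 pn pI.
have NE : N = H^T *m diag_mx phi *m H := affinity_hartley fg n0 pn yp.
have fsym : forall a b, f a b = f b a by case: fBL.
have f01 : forall a b, 0 <= f a b <= 1 by case: fBL.
have Fsym : F^T = F by apply/matrixP => i j; rewrite !mxE fsym.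
have Nsym : N^T = N by apply/matrixP => i j; rewrite !mxE fsym.
have c1_ge : 31 <= c1.
  have : 0 <= cL * ca by rewrite mulr_ge0 // ltW.
  by rewrite /c1; lra.
set eta := c1 * r.
have eta31 : 31 <= eta by rewrite /eta -[31]mulr1 ler_pM.
have eta0 : 0 < eta by move: eta31; clear=> *; lra.
have epsE : n%:R * BLeps ce n = ce * r by rewrite /BLeps -/sq mulrCA scale.
have FN_le z : `|qform (F - N) z| <= (2 * (2 * cL * ca + ce) * r) * sqnorm z.
  have -> : 2 * (2 * cL * ca + ce) * r = n%:R * (2 * (cL * beta + BLeps ce n)).
    by rewrite mulrCA [n%:R * _]mulrDr epsE -scale /beta; ring.
  by apply: qform_entry_le => i j; apply: affinity_perturbation fBL cL0 xy.
have AF_le z : `|qform (A - F) z| <= (31 * r) * sqnorm z.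
  have := @qform_noise_le R n A F (15 * r) z Asym Fsym A0.
  have FD i : 0 <= F i i <= 1 by rewrite mxE.
  move=> /(_ FD (noise (fun i => z 0 i))) h; apply: le_trans h _.
  by rewrite ler_wpM2r ?sqnorm_ge0 //; lra.
have eta_split : eta = 2 * (2 * cL * ca + ce) * r + 31 * r + 2 * ce * r.
  by rewrite /eta /c1; ring.
have cer0 : 0 <= 2 * ce * r by rewrite !mulr_ge0 // (le_trans ler01).
have r31 : 0 <= 31 * r by move: r1; clear=> *; lra.
have kr : 0 <= 2 * (2 * cL * ca + ce) * r.
  have : 0 <= cL * ca by rewrite mulr_ge0 // ltW.
  by move=> h; rewrite !mulr_ge0 //; move: h ce0 r1; clear=> *; lra.
have FN z : `|qform (F - N) z| <= eta * sqnorm z.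
  apply: le_trans (FN_le z) _; rewrite ler_wpM2r ?sqnorm_ge0 //.
  move: eta_split r31 cer0; clear=> *; lra.
have AN z : `|qform (A - N) z| <= eta * sqnorm z.
  rewrite -[A - N](subrKA F) qformD (le_trans (ler_normD _ _)) //.
  apply: le_trans (lerD (AF_le z) (FN_le z)) _.
  by rewrite -mulrDl ler_wpM2r ?sqnorm_ge0 //; move: eta_split cer0; clear=> *; lra.
pose i0 : 'I_n := Ordinal n0; pose i1 : 'I_n := Ordinal lt1n.
pose i2 : 'I_n := Ordinal ltn1n.
have i01 : i0 != i1 by rewrite -val_eqE.
have i02 : i0 != i2 by rewrite -val_eqE.
have i12 : i1 != i2 by rewrite -val_eqE.
have phiE j : phi 0 j = dft n g j by rewrite mxE.
have G01 m : (m < n)%N -> 0 <= fold_ext g (root_angle R n m) <= 1.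
  by move=> mn; apply: fold_ext_bounds => //; apply: ltnW.
have phi_max j : phi 0 j <= phi 0 i0.
  by rewrite !phiE; apply: dft_le_dft0 => // m /G01/andP[].
have phi_eq : phi 0 i2 = phi 0 i1.
  by rewrite !phiE /= -subn1 dft_sym // ltnW.
have phi_snd j : j != i0 -> phi 0 j <= phi 0 i1 + eta.
  rewrite -val_eqE /= -lt0n => j0; rewrite !phiE /=.
  have jn := ltn_ord j.
  have main k : (0 < k <= q)%N -> dft n g k <= dft n g 1 + eta.
    move=> hk.
    have eps0 : 0 <= BLeps ce n by rewrite /BLeps mulr_ge0 // ltW.
    have Gd m l : (m <= l <= q)%N ->
        fold_ext g (root_angle R (2 * q) l) - BLeps ce n <=
        fold_ext g (root_angle R (2 * q) m).
      rewrite -nE; apply: (@BL_fold_almost_decreasing R n f g fg q cl cL ce) => //.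
      exact: ltW.
    have := dft_le_dft1 q2 hk eps0 Gd; rewrite -nE -[2 * _ * _]mulrA epsE.
    move=> h; apply: le_trans h _; rewrite lerD2l mulrA.
    by move: eta_split r31 kr; clear=> *; lra.
  have [jq|qj] := leqP j q; first by apply: main; rewrite j0.
  by rewrite -(dft_sym g n0 (ltnW jn)); apply/main/fold_index.
have phi_abs j : `|phi 0 j| <= n%:R by rewrite phiE; apply: dft_norm_le.
have off_main (j : 'I_n) : j \notin [set i0; i1; i2]%SET -> (2 <= j <= 2 * q - 2)%N.
  rewrite !inE !negb_or -!val_eqE /= => /andP[/andP[j0 j1] j2].
  exact: off_index.
have [sA [u [v [As [uA vA] [u1 v1 uv] XE]]]] := vanilla_spectral_frame Asym XA.
have l0_le := eigenvalue0_le n4 HH NE Fsym Flam FN phi_max.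
have l0_ge := @eigenvalue0_ge R n F N H phi lam eta i0 n4 HH NE Fsym Flam FN phi_max.
have l1_le := eigenvalue1_le n4 HH NE Fsym Flam FN phi_snd.
have l2_ge := eigenvalue2_ge n4 HH NE Fsym Flam FN i01 i02 i12 phi_max phi_eq.
have l12 := @eigenvalue_decr R n F lam n4 Fsym Flam 1 isT.
have a1_le := eigenvalue1_le n4 HH NE Asym As AN phi_snd.
have a2_ge := eigenvalue2_ge n4 HH NE Asym As AN i01 i02 i12 phi_max phi_eq.
have a12 := @eigenvalue_decr R n A sA n4 Asym As 1 isT.
split; last split.
- by rewrite XE; apply: ortho_loss_trivial.
- rewrite -/eta => gap.
  have d1 : delta <= lam`_0 - lam`_1 by rewrite ge_min lexx.
  have d2 : delta <= lam`_2 - lam`_3 by rewrite ge_min lexx orbT.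
  have delta0 : 0 < delta by move: gap eta0; clear=> *; lra.
  (* The gaps of [lam] pass to [phi] with a loss of 4 eta at [i0] and 5 eta elsewhere, so 10 eta <=
     delta leaves at least half of delta. *)
  have sep (sigma : R) j : sA`_2 <= sigma -> sigma <= sA`_1 -> j != i1 -> j != i2 ->
      delta / 2 <= `|phi 0 j - sigma|.
    move=> s1 s2 j1 j2; rewrite -/eta in gap.
    have [j0|j0] := eqVneq j i0.
      by rewrite j0; apply: le_trans (ler_norm _);
      move: gap d1 l0_le l12 l2_ge a1_le s2 eta0; clear=> *; lra.
    have jN : j \notin [set i0; i1; i2]%SET.
      by rewrite !inE !negb_or j0 j1 j2.
    have l3 := eigenvalue3_ge n4 HH NE Fsym Flam FN i01 i02 i12 phi_max phi_eq
      phi_snd (ltW eta0) jN.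
    by rewrite distrC; apply: le_trans (ler_norm _);
      move: gap d2 l1_le l12 a2_ge s1 l3 eta0; clear=> *; lra.
  have h0 : 0 < delta / 2 by rewrite divr_gt0.
  have tu := eigenvector_tail HH NE Asym AN eta0 Nsym h0 uA u1
    (fun j j1 j2 => sep _ j a12 (lexx _) j1 j2).
  have tv := eigenvector_tail HH NE Asym AN eta0 Nsym h0 vA v1
    (fun j j1 j2 => sep _ j (lexx _) a12 j1 j2).
  set rho := eta / (delta / 2) in tu tv.
  have rho0 : 0 < rho by rewrite divr_gt0.
  have rho2 : rho <= 2^-1 by rewrite ler_pdivrMr //; move: gap eta0; clear=> *; lra.
  have := ortho_loss_frame n4 pn pI yp xy (erefl : i1 = 1%N :> nat)
    (erefl : i2 = n.-1 :> nat) rho0 rho2 u1 v1 uv tu tv.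
  rewrite -XE => h; apply: le_trans h _.
  have e1 : 5 / 2 * n%:R * rho = 5 * c1 * (n%:R * r / delta).
    by rewrite /rho /eta; field; rewrite gt_eqF.
  have e2 : 4 * n%:R * beta = 8 * ca * r by rewrite /beta -scale; ring.
  rewrite e1 e2 [leRHS]mulrDl lerD2l -[leRHS]mulrA ler_wpM2l //.
    by move: ca0; clear=> *; lra.
  (* Moving from [y] back to [x] costs 8 ca r regardless of the gap; since delta = O(n), this fits
     under a multiple of n r / delta. *)
  have delta_le : delta <= (2 + 2 * c1) * n%:R.
    have := phi_abs i0; have := phi_abs i1; rewrite !ler_norml.
    move=> /andP[b1 _] /andP[_ b0].
    have : eta <= c1 * n%:R by rewrite ler_wpM2l //; move: c1_ge; clear=> *; lra.
    move: d1 l0_le l12 l2_ge b1 b0; clear=> *; lra.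
  rewrite !mulrA ler_pdivlMr // mulrC ler_wpM2r //; move: r1; clear=> *; lra.
(* The first gap loses eta on [lam] of index 0 and 2 eta on index 1, hence the 3; the second gap
   loses only 2 eta. *)
- rewrite le_min; apply/andP; split.
    have : Num.min (Phi1 n g) (Phi2 n g) <= Phi1 n g by rewrite ge_min lexx.
    rewrite /Phi1 -[dft n g 0](phiE i0) -[dft n g 1](phiE i1) -mulrA -/eta.
    by move: l0_ge l1_le eta0; clear=> *; lra.
  have : Num.min (Phi1 n g) (Phi2 n g) <= Phi2 n g by rewrite ge_min lexx orbT.
  have := eigenvalue3_le n4 HH NE Fsym Flam FN i01 i02 i12
    (t := phi 0 i1 - Phi2 n g).
  have hPhi j : j \notin [set i0; i1; i2]%SET -> phi 0 j <= phi 0 i1 - Phi2 n g.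
    by move=> /off_main hj; rewrite !phiE /=; apply: (dft_le_Phi2 g nE q2).
  by move=> /(_ hPhi); rewrite -mulrA -/eta; move: l2_ge eta0; clear=> *; lra.
Qed.

Theorem proposition4p4 (R : realType) (cl cL ce ca : R)
    (hca : 0 < ca) (hce : 0 <= ce) (hcl : 0 < cl) (hcL : cl <= cL) :
  exists C C' : R, [/\ 0 < C, 0 < C' &
    forall (n : nat) (f : circle R -> circle R -> R) (g : R -> R)
      (x : 'I_n -> circle R) (lam : seq R)
      (d : measure_display) (T : measurableType d) (P : probability T R)
      (E : 'I_n -> 'I_n -> {RV P >-> R}) (A : T -> 'M[R]_n)
      (xhat : T -> 'M[R]_(2, n)),
    (4 <= n)%N -> (4 %| n)%N ->
    BL cl cL ce n f ->
    (forall t : R, 0 <= t <= pi -> 0 <= g t <= 1) ->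
    (forall y z, f y z = g (cdist y z)) ->
    cdist_regular x <= ca * Num.sqrt (ln n%:R / n%:R) ->
    spectrum (affinity_mx f x) lam ->
    (forall w, (A w)^T = A w) ->
    (forall w i, A w i i = 0) ->
    (forall w (i j : 'I_n), (i < j)%N ->
       A w i j = affinity_mx f x i j + E i j w) ->
    (forall i j : 'I_n, (i < j)%N ->
       P.-integrable setT (EFin \o E i j) /\ 'E_P[E i j]%E = 0%E) ->
    mutually_independent P
      [set p : 'I_n * 'I_n | (p.1 < p.2)%N]%SET (fun p => E p.1 p.2) ->
    subgaussian1 P (fun i j => E i j) ->
    (forall w, vanilla_spectral (A w) (xhat w)) ->
    let Delta1 := lam`_0 - lam`_1 in
    let Delta2 := lam`_2 - lam`_3 in
    let r := Num.sqrt (n%:R * ln n%:R) in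
    with_prob_ge P (1 - (n%:R ^+ 2)^-1)
      [set w | ortho_loss (xhat w) (circle_mx x)
                 <= C * (n%:R * r / Num.max (Num.min Delta1 Delta2) 1) /\
               C * (n%:R * r / Num.max (Num.min Delta1 Delta2) 1)
                 <= C * (n%:R * r /
                      Num.max (Num.min (Phi1 n g) (Phi2 n g) - C' * r) 1)]].
Proof.
pose c1 := 2 * (2 * cL * ca + ce) + 31 + 2 * ce.
have cLca : 0 <= cL * ca by rewrite mulr_ge0 ?(ltW hca) // (le_trans (ltW hcl)).
have c1_ge : 31 <= c1 by rewrite /c1; lra.
pose C2 := 5 * c1 + 8 * ca * (2 + 2 * c1).
have C2_ge0 : 0 <= C2.
  by rewrite addr_ge0 ?mulr_ge0 ?(ltW hca) //; lra.
(* [C2] serves the case delta >= 10 c1 r. In the other case [Num.max delta 1] is at most 10 c1 r,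
   and 40 c1 turns the trivial bound 4 n into the required form. *)
exists (40 * c1 + C2), (3 * c1); split; [lra|lra|].
move=> n f g x lam d T P E A xhat n4 n4d fBL g01 fg xreg Flam Asym A0 AE _ _ subg XA.
move=> Delta1 Delta2 r.
have [q nE] : exists q, n = (2 * q)%N.
  by case/dvdnP: n4d => m ->; exists (2 * m)%N; lia.
have mE i j : measurable_fun setT (E i j : T -> R) by [].
have [G [mG GP] PG] := noise_event n4 mE subg.
exists G => //; split=> // w /GP /= noise.
have [_ r1 _] := ln_nat_bounds R n4; rewrite -/r in r1 noise.
have noise' (z : 'I_n -> R) :
    `|pair_sum (fun i j => z i * z j * (A w i j - affinity_mx f x i j))| <=
    15 * r * \sum_i z i ^+ 2.
  have -> : pair_sum (fun i j => z i * z j * (A w i j - affinity_mx f x i j)) =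
    pair_sum (fun i j => z i * z j * E i j w); last exact: noise.
  by apply: eq_bigr => i _; apply: eq_bigr => j ij; rewrite AE // addrAC subrr add0r.
have := spectral_loss_bounds hca hce hcl hcL n4 nE fBL g01 fg xreg Flam
  (Asym w) (A0 w) noise' (XA w).
rewrite -/c1 -/r -/Delta1 -/Delta2.
set delta := Num.min Delta1 Delta2; set loss := ortho_loss _ _.
move=> [loss1 [loss2 gapPhi]].
have nr0 : 0 <= n%:R * r by rewrite mulr_ge0 ?ler0n // (le_trans ler01).
have max0 (t : R) : 0 < Num.max t 1 by rewrite lt_max ltr01 orbT.
split; last first.
  rewrite ler_wpM2l //; first by lra.
  rewrite ler_wpM2l // lef_pV2 ?posrE //.
  by rewrite ge_max le_max gapPhi /= le_max lexx orbT.
have q0 : 0 <= n%:R * r / Num.max delta 1 by rewrite divr_ge0 // ltW.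
have [gap|gap] := leP (10 * (c1 * r)) delta.
  have c1r : 1 <= 10 * (c1 * r).
    have : 31 * 1 <= c1 * r by rewrite ler_pM.
    by lra.
  have -> : Num.max delta 1 = delta by apply/max_idPl; apply: le_trans gap.
  have d0 : 0 < delta by apply: lt_le_trans gap; lra.
  apply: le_trans (loss2 gap) _; rewrite ler_wpM2r ?divr_ge0 ?(ltW d0) //.
  by rewrite -/C2; lra.
have max_le : Num.max delta 1 <= 10 * (c1 * r).
  have : 31 * 1 <= c1 * r by rewrite ler_pM.
  by move=> h; rewrite ge_max (ltW gap) /=; lra.
apply: le_trans loss1 _; rewrite [leRHS]mulrDl.
apply: (@le_trans _ _ (40 * c1 * (n%:R * r / Num.max delta 1))); last first.
  by rewrite lerDl mulr_ge0.
rewrite mulrA ler_pdivlMr //.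
apply: (@le_trans _ _ (4 * n%:R * (10 * (c1 * r)))).
  by rewrite ler_wpM2l // mulr_ge0.
by rewrite le_eqVlt; apply/orP; left; apply/eqP; ring.
Qed.
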